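(* Let $\Sigma$ be a compact Riemann surface of genus $h\ge1$ with period matrix $\Omega$. Suppose that there are integer vectors $n,m,n',m'\in\mathbb{Z}^h$ with $(n,m)\neq(0,0)$ and $c\in\mathbb{C}\setminus\mathbb{Q}$ such that $$m_j'-\sum_{k=1}^h\Omega_{jk}n_k'=\overline{c}\Big(m_j-\sum_{k=1}^h\Omega_{jk}n_k\Big),\qquad j=1,\dots,h.$$ Define integer $h\times h$ matrices by $$N_{jk}=n_j'n_k-n_k'n_j,\qquad M_{jk}=m_k'n_j-m_kn_j',\qquad M'_{jk}=m_k'm_j-m_j'm_k .$$ Then $$\Omega N\Omega+\Omega M-M^{T}\Omega-M'=0,$$ where $M^T$ is the transpose of $M$. In particular, the Jacobian of $\Sigma$ admits complex multiplication, in the sense that $\Omega(M+N\Omega)=M'+N'\Omega$ holds with these integer matrices $N,M,M'$ and $N'=M^T$.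
   Context: Let $\alpha_1,\dots,\alpha_h,\beta_1,\dots,\beta_h$ be a symplectic basis of $H_1(\Sigma,\mathbb{Z})$. Let $\omega_1,\dots,\omega_h$ be the basis of holomorphic one-differentials on $\Sigma$ with $\oint_{\alpha_j}\omega_k=\delta_{jk}$. The period matrix is $\Omega_{jk}=\oint_{\beta_j}\omega_k$. A surface satisfying the hypothesis is called a Special Riemann surface. In the paper's terminology, the Jacobian admits complex multiplication if there exist integer matrices $N,M,M',N'$ such that $\Omega(M+N\Omega)=M'+N'\Omega$. *)

(* Defs.v *)
From HB Require Import structures.
From mathcomp Require Import all_boot all_order all_algebra.
From mathcomp Require Import all_classical all_reals all_analysis.
From mathcomp Require Import complex freeg.
Set Implicit Arguments.
Unset Strict Implicit.
Unset Printing Implicit Defensive.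
Import Order.TTheory GRing.Theory Num.Theory numFieldNormedType.Exports.
Local Open Scope classical_set_scope.
Local Open Scope ring_scope.

(* R[i], packed as a numClosedFieldType so that it inherits the normed topology
   of its absolute value; derivable and 'D_1 over CC are then complex
   differentiability and the complex derivative. *)
Definition CC (R : realType) : numClosedFieldType := R[i].

(* chart_fun is only meaningful on chart_dom, and chart_inv on its image. *)
Record chart (R : realType) (S : topologicalType) := Chart {
  chart_dom : set S ;
  chart_fun :> S -> CC R ;
  chart_inv : CC R -> S
}.

Definition is_chart (R : realType) (S : topologicalType) (f : chart R S) :=
  [/\ open (chart_dom f),
      open (f @` chart_dom f),
      forall p, chart_dom f p -> chart_inv f (f p) = p,
      forall p, chart_dom f p -> {for p, continuous f} &
      forall p, chart_dom f p -> {for f p, continuous (chart_inv f)}].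

Record is_atlas (R : realType) (S : topologicalType) (A : set (chart R S)) :
  Prop := {
  atlas_chart : forall f, A f -> is_chart f ;
  atlas_cover : forall p, exists2 f, A f & chart_dom f p ;
  atlas_transition : forall f g p, A f -> A g ->
    chart_dom f p -> chart_dom g p -> derivable (g \o chart_inv f) (f p) 1
}.

Record riemannSurface (R : realType) := RiemannSurface {
  surface :> topologicalType ;
  atlas : set (chart R surface) ;
  surface_nonempty : [set: surface] !=set0 ;
  surface_hausdorff : hausdorff_space surface ;
  surface_connected : connected [set: surface] ;
  surface_atlas : is_atlas atlas
}.
Arguments atlas {R} S : rename.

Definition stdsimplex (R : realType) n : set 'rV[R]_n.+1 :=
  [set t | (forall i, 0 <= t 0 i) /\ \sum_i t 0 i = 1].

Lemma vertex_subproof (R : realType) n (i : 'I_n.+1) :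
  (delta_mx 0 i : 'rV[R]_n.+1) \in @stdsimplex R n.
Proof.
apply/mem_set; split=> [j|]; first by rewrite mxE ler0n.
rewrite (bigD1 i) //= mxE !eqxx big1 ?addr0 // => j /negPf ji.
by rewrite mxE ji andbF.
Qed.

Definition vertex (R : realType) n (i : 'I_n.+1) : @stdsimplex R n :=
  exist (fun t => t \in @stdsimplex R n) _ (vertex_subproof R i).

Definition insert0 (R : realType) n (i : 'I_n.+2) (t : 'rV[R]_n.+1) :
  'rV[R]_n.+2 := \row_j (if unlift i j is Some k then t 0 k else 0).

Lemma insert0_subproof (R : realType) n (i : 'I_n.+2) (t : @stdsimplex R n) :
  insert0 i (set_val t) \in @stdsimplex R n.+1.
Proof.
have [t_ge0 t_sum] := set_valP t.
apply/mem_set; split=> [j|].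
  by rewrite mxE; case: unlift => [k|//]; exact: t_ge0.
rewrite (bigD1_ord i) //= mxE unlift_none add0r -[RHS]t_sum.
by apply: eq_bigr => k _; rewrite mxE liftK.
Qed.

Definition coface (R : realType) n (i : 'I_n.+2) (t : @stdsimplex R n) :
  @stdsimplex R n.+1 :=
  exist (fun u => u \in @stdsimplex R n.+1) _ (insert0_subproof i t).

Lemma coface_continuous (R : realType) n (i : 'I_n.+2) :
  continuous (@coface R n i).
Proof.
apply: continuous_comp_initial.
suff insert0_cont : continuous (@insert0 R n i).
  move=> t; apply: (@continuous_comp _ _ _ set_val (insert0 i)).
    exact: initial_continuous.
  exact: insert0_cont.
move=> t V /= /nbhs_ballP[e /= e0 eV].
apply/nbhs_ballP; exists e => //= u [_ tu]; apply: eV; split=> // a b.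
by rewrite !mxE; case: unlift => [k|]; [exact: tu | exact: ballxx].
Qed.

HB.instance Definition _ (R : realType) n (i : 'I_n.+2) :=
  isContinuous.Build _ _ (@coface R n i) (@coface_continuous R n i).

Notation simplex R S n := (continuousType (@stdsimplex R n) S).
Notation chain R S n := {freeg (simplex R S n) / int}.

Section SingularHomology.
Variables (R : realType) (S : topologicalType).

Definition face n (i : 'I_n.+2) (sigma : simplex R S n.+1) : simplex R S n :=
  sigma \o @coface R n i.

(* zmodule V is V viewed as a module over int. *)
Definition extend n (V : zmodType) (f : simplex R S n -> V) (c : chain R S n) :
  V := fglift (f : _ -> zmodule V) c.

Definition boundary n (c : chain R S n.+1) : chain R S n :=
  extend (fun sigma => \sum_(i < n.+2) << (-1) ^+ i *g face i sigma >>) c.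

Definition is_cycle n (c : chain R S n.+1) := boundary c = 0.

Definition homologous n (a b : chain R S n) :=
  exists c : chain R S n.+1, a - b = boundary c.

Definition cocycle n (phi : simplex R S n -> int) :=
  forall c : chain R S n.+1, extend phi (boundary c) = 0.

(* face ord_max and face ord0 are the edges [v0, v1] and [v1, v2]. *)
Definition cup (phi psi : simplex R S 1 -> int) (tau : simplex R S 2) : int :=
  phi (face ord_max tau) * psi (face ord0 tau).

Definition cap (c : chain R S 2) (phi : simplex R S 1 -> int) : chain R S 1 :=
  extend (fun tau => << phi (face ord_max tau) *g face ord0 tau >>) c.

Definition poincare_dual (s : chain R S 2) (phi : simplex R S 1 -> int)
    (a : chain R S 1) :=
  cocycle phi /\ homologous (cap s phi) a.

(* The intersection number of the classes of a and b is the cup product of their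
   Poincare duals evaluated on the fundamental cycle s. It is a relation
   because duals are only determined up to coboundaries. *)
Definition intersection_number (s : chain R S 2) (a b : chain R S 1) (k : int) :=
  exists phi psi, [/\ poincare_dual s phi a, poincare_dual s psi b &
                      k = extend (cup phi psi) s].

(* A basis of H_1 is given by cycles representing it; it has 2 h elements, so on a
   compact Riemann surface h is the genus. *)
Definition homology_basis h (alpha beta : 'I_h -> chain R S 1) :=
  [/\ forall j, is_cycle (alpha j), forall j, is_cycle (beta j) &
      forall c : chain R S 1, is_cycle c ->
        exists! xy : 'rV[int]_h * 'rV[int]_h,
          homologous c
            (\sum_j (alpha j *~ xy.1 0 j + beta j *~ xy.2 0 j))].

Definition symplectic_basis (s : chain R S 2) h
    (alpha beta : 'I_h -> chain R S 1) :=
  homology_basis alpha beta /\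
  forall i j, [/\ intersection_number s (alpha i) (beta j) (i == j)%:R,
                  intersection_number s (alpha i) (alpha j) 0 &
                  intersection_number s (beta i) (beta j) 0].

End SingularHomology.

Section Differentials.
Variables (R : realType) (S : riemannSurface R).
Local Notation C := (CC R).

(* In the chart f, tau is the affine triangle with vertices f p + r (-1 - i),
   f p + r and f p + r i: it has barycenter f p and is positively oriented. *)
Definition small_triangle (f : chart R S) (p : S) (r : R) (tau : simplex R S 2) :=
  forall t, chart_dom f (tau t) /\
    f (tau t) = f p + (Complex
      (r * (set_val t 0 (inord 1) - set_val t 0 (inord 0)))
      (r * (set_val t 0 (inord 2) - set_val t 0 (inord 0))) : C).

(* The image of s in H_2(S, S \ {p}) is the positive local generator at every
   point p, for the orientation given by the complex structure. *)
Definition fundamental_cycle (s : chain R S 2) :=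
  is_cycle s /\
  forall f p, atlas S f -> chart_dom f p ->
    exists (r : R) (tau : simplex R S 2) (c : chain R S 3) (d : chain R S 2),
      [/\ 0 < r, small_triangle f p r tau,
          s - << tau >> = boundary c + d &
          forall sigma, sigma \in dom d -> ~ range sigma p].

(* omega stands for the one-form equal to omega f df on the domain of each
   chart f of the atlas; other values of omega are irrelevant. *)
Definition one_form := chart R S -> S -> C.

Definition holomorphic_form (omega : one_form) :=
  (forall f p, atlas S f -> chart_dom f p ->
     derivable (omega f \o chart_inv f) (f p) 1) /\
  (forall f g p, atlas S f -> atlas S g -> chart_dom f p -> chart_dom g p ->
     omega f p = omega g p * 'D_1 (g \o chart_inv f) (f p)).

Definition holomorphic_basis h (omega : 'I_h -> one_form) :=
  (forall k, holomorphic_form (omega k)) /\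
  forall eta, holomorphic_form eta ->
    exists! c : 'rV[C]_h, forall f p, atlas S f -> chart_dom f p ->
      eta f p = \sum_k c 0 k * omega k f p.

Definition primitive_on (omega : one_form) (U : set S) (F : S -> C) :=
  forall f p, atlas S f -> chart_dom f p -> U p ->
    is_derive (f p) (1 : C) (F \o chart_inv f) (omega f p).

Definition primitive_along (omega : one_form) (sigma : simplex R S 1)
    (G : @stdsimplex R 1 -> C) :=
  forall t, exists (U : set S) (F : S -> C),
    [/\ open U, U (sigma t), primitive_on omega U F &
        \forall u \near t, G u = F (sigma u)].

(* The integral of a holomorphic form along a continuous path, obtained by
   continuing local primitives along it. *)
Definition path_integral (omega : one_form) (sigma : simplex R S 1) : C :=
  xget 0 [set z | exists2 G, primitive_along omega sigma G &
                  z = G (vertex R ord_max) - G (vertex R ord0)].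

Definition period (omega : one_form) (c : chain R S 1) : C :=
  extend (path_integral omega) c.

Definition period_matrix h (omega : 'I_h -> one_form)
    (beta : 'I_h -> chain R S 1) : 'M[C]_h :=
  \matrix_(j, k) period (omega k) (beta j).

End Differentials.

Definition intmx (R : realType) h (A : 'M[int]_h) : 'M[CC R]_h :=
  map_mx intr A.

Definition cm_relation (R : realType) h (Omega : 'M[CC R]_h)
    (N M M' N' : 'M[int]_h) :=
  Omega *m (intmx R M + intmx R N *m Omega) = intmx R M' + intmx R N' *m Omega.

Definition admits_complex_multiplication (R : realType) h
    (Omega : 'M[CC R]_h) :=
  exists N M M' N', cm_relation Omega N M M' N'.

(* Main.v *)
Require Import Defs.
From HB Require Import structures.
From mathcomp Require Import all_boot all_order all_algebra.
From mathcomp Require Import all_classical all_reals all_analysis.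
From mathcomp Require Import complex freeg.
From mathcomp Require Import ring lra.
Import Order.TTheory GRing.Theory Num.Theory numFieldNormedType.Exports.
Local Open Scope classical_set_scope.
Local Open Scope ring_scope.
Set Implicit Arguments.
Unset Strict Implicit.
Unset Printing Implicit Defensive.

(* The relation v' = c^* v, where v = m - Omega n and v' = m' - Omega n', says
   that the antisymmetric matrix v' v^T - v v'^T vanishes. Expanding it gives the
   claim as soon as Omega is symmetric, so everything rests on the Riemann
   bilinear relation for holomorphic forms.

   The periods of holomorphic forms omega and eta are closed singular 1-cochains.
   For a singular 2-simplex with vertices v0, v1, v2, and primitives f of omega,
   g of eta and h of f eta along it, the iterated integral over an edge [a, b] is
   h(b) - h(a) - f(a) (g(b) - g(a)), and a direct computation shows that the cup
   product of the two period cochains is the coboundary of minus the iterated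
   integral. The form f eta has primitives because it is again holomorphic: this
   is where the wedge product of omega and eta being zero enters. Hence the cup
   product vanishes on every 2-cycle s. On the other hand, the Poincare duals of
   a symplectic basis express each period cochain, up to a coboundary, by its
   periods, and the cup product evaluated on s becomes the sum over l of
   A_l(omega) B_l(eta) - B_l(omega) A_l(eta).

   Local primitives come from Goursat's theorem for rectangles, and primitives
   along a singular simplex from a continuation argument on the unit square;
   these and the mean value inequality all follow from one bisection principle. *)

(** * Bisection *)

Section Bisection.
Variable R : realType.
Implicit Types (s t l : R).

(** [Q s t l] concerns the closed square with lower left corner (s, t) and side [l]. If it failed on
    the unit square, it would fail on a nested sequence of dyadic squares. Their common point
    contradicts the local hypothesis. *)
Lemma bisection (Q : R -> R -> R -> Prop) :
  (forall s t l, 0 < l -> 0 <= s -> s + l <= 1 -> 0 <= t -> t + l <= 1 ->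
     Q s t (l / 2) -> Q (s + l / 2) t (l / 2) ->
     Q s (t + l / 2) (l / 2) -> Q (s + l / 2) (t + l / 2) (l / 2) ->
     Q s t l) ->
  (forall s t, 0 <= s <= 1 -> 0 <= t <= 1 -> exists2 d : R, 0 < d &
     forall s' t' l, 0 < l -> l < d -> 0 <= s' -> s' + l <= 1 ->
       0 <= t' -> t' + l <= 1 -> s' <= s <= s' + l -> t' <= t <= t' + l ->
       Q s' t' l) ->
  Q 0 0 1.
Proof.
move=> split local; apply: contrapT => nQ.
pose ok n (p : R * R) := let l := 2^-1 ^+ n in
  [/\ 0 <= p.1, p.1 + l <= 1, 0 <= p.2, p.2 + l <= 1 & ~ Q p.1 p.2 l].
pose sub n (p p' : R * R) := let l := 2^-1 ^+ n in let l' := 2^-1 ^+ n.+1 in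
  [/\ p.1 <= p'.1, p'.1 + l' <= p.1 + l, p.2 <= p'.2 & p'.2 + l' <= p.2 + l].
have l_gt0 n : 0 < (2^-1 ^+ n : R) by rewrite exprn_gt0.
have step n p : ok n p -> exists p', ok n.+1 p' /\ sub n p p'.
  case: p => s t [/= s0 s1 t0 t1 nq]; apply: contrapT => np.
  have lE : (2^-1 ^+ n.+1 : R) = 2^-1 ^+ n / 2 by rewrite exprS mulrC.
  have l0 := l_gt0 n.
  apply: nq; apply: split => //; rewrite -lE; apply: contrapT => nq; apply: np.
  - exists (s, t); rewrite /ok /sub /= lE.
    by split; split=> //=; try lra; rewrite -lE.
  - exists (s + 2^-1 ^+ n.+1, t); rewrite /ok /sub /= lE.
    by split; split=> //=; try lra; rewrite -lE.
  - exists (s, t + 2^-1 ^+ n.+1); rewrite /ok /sub /= lE.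
    by split; split=> //=; try lra; rewrite -lE.
  - exists (s + 2^-1 ^+ n.+1, t + 2^-1 ^+ n.+1); rewrite /ok /sub /= lE.
    by split; split=> //=; try lra; rewrite -lE.
(* The default [p] is never returned for a failing square, since [step] supplies a failing
   quarter. *)
pose next n p := xget p [set p' | ok n.+1 p' /\ sub n p p'].
have nextP n p : ok n p -> ok n.+1 (next n p) /\ sub n p (next n p).
  by move=> /step[p' p'P]; rewrite /next; case: xgetP => [q _ //|/(_ p')].
pose u := fix u n : R * R := if n is n'.+1 then next n' (u n') else (0, 0).
have uok n : ok n (u n).
  elim: n => [|n /nextP[]//]; rewrite /ok /= expr0; split; by rewrite ?add0r.
have usub n : sub n (u n) (u n.+1) by have [] := nextP n _ (uok n).
have mono (n k : nat) : [/\ (u n).1 <= (u (n + k)%N).1,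
   (u (n + k)%N).1 + 2^-1 ^+ (n + k) <= (u n).1 + 2^-1 ^+ n,
   (u n).2 <= (u (n + k)%N).2 &
   (u (n + k)%N).2 + 2^-1 ^+ (n + k) <= (u n).2 + 2^-1 ^+ n].
  elim: k => [|k [h1 h2 h3 h4]]; first by rewrite addn0.
  rewrite addnS; have [/= k1 k2 k3 k4] := usub (n + k)%N.
  by split; [exact: le_trans k1 | exact: le_trans h2 | exact: le_trans k3 | exact: le_trans h4].
(* Left ends increase and stay below every right end, so their supremum lies in all the nested
   intervals. *)
have lim (v : nat -> R) :
    (forall n k : nat, v n <= v (n + k)%N /\
       v (n + k)%N + 2^-1 ^+ (n + k) <= v n + 2^-1 ^+ n) ->
    exists x, forall n, v n <= x <= v n + 2^-1 ^+ n.
  move=> vm.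
  have vub n k : v k <= v n + 2^-1 ^+ n.
    have [nk|/ltnW kn] := leqP n k.
      by have [_] := vm n (k - n)%N; rewrite subnKC//; have := l_gt0 k; lra.
    by have [+ _] := vm k (n - k)%N; rewrite subnKC//; have := l_gt0 n; lra.
  have hs : has_sup (range v).
    split; first by exists (v 0%N); exists 0%N.
    by exists (v 0%N + 2^-1 ^+ 0) => _ [k _ <-].
  exists (sup (range v)) => n; apply/andP; split.
    by apply: ub_le_sup; [exact: hs.2 | exists n].
  by apply: ge_sup; [exact: hs.1 | move=> _ [k _ <-]].
have [s sP] : exists x, forall n, (u n).1 <= x <= (u n).1 + 2^-1 ^+ n.
  by apply: (lim (fun n => (u n).1)) => n k; have [] := mono n k.
have [t tP] : exists x, forall n, (u n).2 <= x <= (u n).2 + 2^-1 ^+ n.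
  by apply: (lim (fun n => (u n).2)) => n k; have [] := mono n k.
have [||d d0 dP] := local s t.
- by have := sP 0%N; rewrite /= expr0 add0r.
- by have := tP 0%N; rewrite /= expr0 add0r.
have [n nd] : exists n, (2^-1 ^+ n : R) < d.
  (* With k the integer part of 1/d, one has 1/d < k + 1 <= 2^k. *)
  exists (Num.truncn d^-1).
  have h1 := truncnS_gt d^-1.
  have h2 : (Num.truncn d^-1).+1%:R <= 2 ^+ (Num.truncn d^-1) :> R.
    by rewrite -natrX ler_nat ltn_expl.
  rewrite exprVn invf_plt ?posrE//; exact: lt_le_trans h2.
have [/= h1 h2 h3 h4] := uok n; apply.
by apply: dP.
Qed.

Lemma bisection1 (Q : R -> R -> Prop) :
  (forall s l, 0 < l -> 0 <= s -> s + l <= 1 ->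
     Q s (l / 2) -> Q (s + l / 2) (l / 2) -> Q s l) ->
  (forall s, 0 <= s <= 1 -> exists2 d : R, 0 < d &
     forall s' l, 0 < l -> l < d -> 0 <= s' -> s' + l <= 1 ->
       s' <= s <= s' + l -> Q s' l) ->
  Q 0 1.
Proof.
move=> split local; apply: (@bisection (fun s _ l => Q s l)).
  by move=> s t l l0 s0 s1 _ _ q1 q2 _ _; exact: split.
move=> s t s01 _; have [d d0 dP] := local s s01.
by exists d => // s' t' l l0 ld s0 s1 _ _ ss _; exact: dP.
Qed.

End Bisection.

(** * Complex derivatives and the mean value inequality *)

(** Multiplying the difference quotient by the increment gives a bound that also holds at [w = x],
    so no punctured neighbourhood remains. *)
Lemma is_derive_epsP (K : numFieldType) (f : K -> K) (x d : K) :
  is_derive x (1 : K) f d <->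
  forall e, 0 < e -> exists2 r, 0 < r & forall w, `|w - x| < r ->
    `|f w - f x - d * (w - x)| <= e * `|w - x|.
Proof.
have key (e h : K) : h != 0 ->
    (`|d - h^-1 *: (f (h *: 1 + x) - f x)| <= e) =
    (`|f (h + x) - f x - d * h| <= e * `|h|).
  move=> h0; rewrite -(ler_pM2r (_ : 0 < `|h|)) ?normr_gt0 // -normrM.
  rewrite /GRing.scale /= mulr1 -[in LHS]normrN; congr (`| _ | <= _).
  by rewrite -mulNr opprB mulrBl mulrC mulrA divff // mul1r.
split=> [dfx e e0|H].
  have fx : h^-1 *: (f (h *: 1 + x) - f x) @[h --> 0^'] --> d.
    by rewrite -(@derive_val _ _ _ _ _ _ _ dfx); exact: (@ex_derive _ _ _ _ _ _ _ dfx).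
  have /cvgrPdist_le/(_ e e0) := fx.
  rewrite near_withinE => /nbhs_ballP[r /= r0 rP].
  exists r => // w wr; have [->|wx] := eqVneq w x.
    by rewrite !subrr mulr0 subr0 normr0 mulr0.
  have w0 : w - x != 0 by rewrite subr_eq0.
  have := rP (w - x); rewrite /= key // subrK; apply=> //.
  by rewrite -ball_normE /ball_ /= sub0r normrN.
have cvgd : h^-1 *: (f (h *: 1 + x) - f x) @[h --> 0^'] --> d.
  apply/cvgrPdist_le => e e0; have [r r0 rP] := H e e0.
  rewrite near_withinE; apply/nbhs_ballP; exists r => //= h.
  rewrite -ball_normE /ball_ /= sub0r normrN => hr h0.
  by rewrite key //; have := rP (h + x); rewrite addrK; apply.
split; first by apply/cvg_ex; exists d.
exact: cvg_lim.
Qed.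

Section Complex.
Variable R : realType.
Local Notation C := (CC R).

Definition cplx (x y : R) : C := Complex x y.
(** The norm of [C] takes values in [C], which is only partially ordered. Its real part makes real
    inequalities and their decision procedures available. *)
Definition cmod (z : C) : R := complex.Re `|z|.

Lemma normE (z : C) : `|z| = cplx (cmod z) 0.
Proof. by rewrite /cmod; case: z => a b; rewrite normc_def. Qed.
Lemma cmodD (z w : C) : cmod (z + w) <= cmod z + cmod w.
Proof. by have := ler_normD z w; rewrite !normE lecE /= => /andP[]. Qed.
Lemma cmodM (z w : C) : cmod (z * w) = cmod z * cmod w.
Proof. by rewrite /cmod normrM !normE /= mulr0 subr0. Qed.
Lemma cmodN (z : C) : cmod (- z) = cmod z.
Proof. by rewrite /cmod normrN. Qed.
Lemma cmod_ge0 (z : C) : 0 <= cmod z.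
Proof. by have := normr_ge0 z; rewrite normE lecE /= => /andP[]. Qed.
Lemma cmod0_eq0 (z : C) : cmod z <= 0 -> z = 0.
Proof.
move=> z0; apply/eqP; rewrite -normr_eq0 normE; apply/eqP.
by have -> : cmod z = 0 by apply/eqP; rewrite eq_le z0 cmod_ge0.
Qed.
Lemma cmod_re (z : C) : `|complex.Re z| <= cmod z.
Proof. by have := normc_ge_Re z; rewrite [X in _ <= X]normE lecE /= => /andP[]. Qed.
Lemma cmod_i : cmod (cplx 0 1) = 1.
Proof. by rewrite /cmod normc_def /= expr0n /= add0r expr1n sqrtr1. Qed.
Lemma cmod_real (x : R) : cmod (cplx x 0) = `|x|.
Proof. by rewrite /cmod normc_def /= expr0n /= addr0 sqrtr_sqr. Qed.
Lemma cmod_im (z : C) : `|complex.Im z| <= cmod z.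
Proof.
rewrite -[cmod z]mul1r -cmod_i -cmodM; case: z => a b.
have := cmod_re (cplx 0 1 * Complex a b : C).
by rewrite /= mul0r mul1r sub0r normrN.
Qed.
Lemma cplxE x y : cplx x y = cplx x 0 + cplx 0 1 * cplx y 0.
Proof. by apply/eqP; rewrite eq_complex /= !mul0r !mul1r subr0 ?add0r ?addr0 !eqxx. Qed.
Lemma cmod_le (x y : R) : cmod (cplx x y) <= `|x| + `|y|.
Proof.
rewrite cplxE; apply: le_trans (cmodD _ _) _.
by rewrite cmodM cmod_i mul1r !cmod_real.
Qed.

(** The complex derivative with real tolerance and radius; [has_derivP] identifies it with
    [is_derive]. The analogue [has_vderiv] is for curves with a real parameter. *)
Definition has_deriv (f : C -> C) (z d : C) := forall e : R, 0 < e ->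
  exists2 r : R, 0 < r & forall w, cmod (w - z) < r ->
    cmod (f w - f z - d * (w - z)) <= e * cmod (w - z).

Definition has_vderiv (g : R -> C) (t : R) (d : C) := forall e : R, 0 < e ->
  exists2 r : R, 0 < r & forall u, `|u - t| < r ->
    cmod (g u - g t - d * cplx (u - t) 0) <= e * `|u - t|.

Lemma has_derivP f z d : is_derive z (1 : C) f d <-> has_deriv f z d.
Proof.
split=> [/is_derive_epsP H e e0|H]; last apply/is_derive_epsP => e e0.
  have [|[r1 r2]] := H (cplx e 0); first by rewrite ltcE /= eqxx.
  rewrite ltcE /= => /andP[/eqP -> r0] rP; exists r1 => // w wr.
  have := rP w; rewrite !normE ltcE lecE /= eqxx /= !mulr0 !mul0r addr0 subr0 eqxx.
  exact.
case: e e0 => e1 e2; rewrite ltcE /= => /andP[/eqP -> e0].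
have [r r0 rP] := H e1 e0; exists (cplx r 0); first by rewrite ltcE /= eqxx.
move=> w; rewrite !normE ltcE lecE /= eqxx /= !mulr0 !mul0r addr0 subr0 eqxx.
exact: rP.
Qed.

Lemma has_deriv_cont f z d : has_deriv f z d -> forall e : R, 0 < e ->
  exists2 r : R, 0 < r & forall w, cmod (w - z) < r -> cmod (f w - f z) < e.
Proof.
move=> H e e0; have [r r0 rP] := H 1 ltr01.
have k0 : 0 < 1 + cmod d by rewrite ltr_pwDl // cmod_ge0.
exists (Num.min r (e / (1 + cmod d))); first by rewrite lt_min r0 divr_gt0.
move=> w; rewrite lt_min => /andP[/rP wr]; rewrite ltr_pdivlMr // => we.
have -> : f w - f z = (f w - f z - d * (w - z)) + d * (w - z) by ring.
apply: le_lt_trans (cmodD _ _) _; rewrite cmodM; apply: le_lt_trans we.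
by rewrite (mulrDr (cmod _)) mulr1 lerD ?(mulrC (cmod d)) // -[leRHS]mul1r.
Qed.

Lemma has_vderiv_line f z v t d :
  has_deriv f (z + cplx t 0 * v) d ->
  has_vderiv (fun u => f (z + cplx u 0 * v)) t (d * v).
Proof.
move=> H e e0; have k0 : 0 < 1 + cmod v by rewrite ltr_pwDl // cmod_ge0.
have [|r r0 rP] := H (e / (1 + cmod v)); first by rewrite divr_gt0.
exists (r / (1 + cmod v)); first by rewrite divr_gt0.
move=> u; rewrite ltr_pdivlMr // => ut.
have E : z + cplx u 0 * v - (z + cplx t 0 * v) = cplx (u - t) 0 * v.
  have -> : cplx (u - t) 0 = cplx u 0 - cplx t 0.
    by apply/eqP; rewrite eq_complex /= subr0 !eqxx.
  ring.
have Em : cmod (cplx (u - t) 0 * v) <= `|u - t| * (1 + cmod v).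
  by rewrite cmodM cmod_real ler_wpM2l // ler_wpDl.
have := rP (z + cplx u 0 * v); rewrite E => /(_ (le_lt_trans Em ut)) h.
rewrite [d * v * _]mulrAC -[d * _ * v]mulrA; apply: le_trans h _.
apply: le_trans (ler_wpM2l _ Em) _; first by rewrite divr_ge0 // ltW.
by rewrite mulrCA divfK ?gt_eqF // mulrC.
Qed.

Lemma has_vderiv_affine g a h t d :
  has_vderiv g (a + t * h) d ->
  has_vderiv (fun u => g (a + u * h)) t (d * cplx h 0).
Proof.
move=> H e e0; have k0 : 0 < 1 + `|h| by rewrite ltr_pwDl.
have [|r r0 rP] := H (e / (1 + `|h|)); first by rewrite divr_gt0.
exists (r / (1 + `|h|)); first by rewrite divr_gt0.
move=> u; rewrite ltr_pdivlMr // => ut.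
have E : a + u * h - (a + t * h) = (u - t) * h by ring.
have Em : `|(u - t) * h| <= `|u - t| * (1 + `|h|).
  by rewrite normrM ler_wpM2l // ler_wpDl.
have := rP (a + u * h); rewrite E => /(_ (le_lt_trans Em ut)) H1.
have -> : d * cplx h 0 * cplx (u - t) 0 = d * cplx ((u - t) * h) 0.
  rewrite -mulrA; congr (_ * _); apply/eqP.
  by rewrite eq_complex /= !mul0r !mulr0 subr0 addr0 mulrC !eqxx.
apply: le_trans H1 _.
apply: le_trans (ler_wpM2l _ Em) _; first by rewrite divr_ge0 // ltW.
by rewrite mulrCA divfK ?gt_eqF // mulrC.
Qed.

(** With slack [e], the bound (M + e) l on increments is additive under halving, and
    differentiability gives it on short intervals around each point. Bisection then yields it on
    [0, 1]. *)
Lemma mean_value01 g (M : R) :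
  (forall t, 0 <= t <= 1 -> exists2 d, has_vderiv g t d & cmod d <= M) ->
  cmod (g 1 - g 0) <= M.
Proof.
move=> H; apply/ler_addgt0Pr => e e0.
have := @bisection1 R (fun s l => cmod (g (s + l) - g s) <= (M + e) * l).
rewrite add0r mulr1; apply=> [s l l0 s0 s1 h1 h2|s s01].
  have -> : g (s + l) - g s = (g (s + l / 2 + l / 2) - g (s + l / 2))
      + (g (s + l / 2) - g s).
    by rewrite -(addrA s) -splitr; ring.
  by apply: le_trans (cmodD _ _) _; lra.
have [d gd dM] := H s s01; have [r r0 rP] := gd e e0.
exists r => // s' l l0 lr s0 s1 /andP[s2 s3].
have h1 : `|s' + l - s| < r by rewrite ltr_norml; lra.
have h2 : `|s' - s| < r by rewrite ltr_norml; lra.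
have {}h1 := rP _ h1; have {}h2 := rP _ h2.
have E : cplx l 0 = cplx (s' + l - s) 0 - cplx (s' - s) 0.
  by apply/eqP; rewrite eq_complex /= subr0 !eqxx andbT; apply/eqP; ring.
(* The increment is split at the point [s] between the two ends. The remainders are at most e (s' +
   l - s) and e (s - s'), which sum to e l. *)
have -> : g (s' + l) - g s' = d * cplx l 0 +
   ((g (s' + l) - g s - d * cplx (s' + l - s) 0) -
    (g s' - g s - d * cplx (s' - s) 0)) by rewrite E; ring.
apply: le_trans (cmodD _ _) _; rewrite mulrDl lerD //.
  by rewrite cmodM cmod_real (ger0_norm (ltW l0)) ler_wpM2r // ltW.
apply: le_trans (cmodD _ _) _; rewrite cmodN.
apply: le_trans (lerD h1 h2) _; rewrite -mulrDr ler_wpM2l ?(ltW e0) //.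
rewrite ger0_norm; last lra.
by rewrite ler0_norm; lra.
Qed.

Lemma mean_value g (a h M : R) :
  (forall t, 0 <= t <= 1 -> exists2 d, has_vderiv g (a + t * h) d & cmod d <= M) ->
  cmod (g (a + h) - g a) <= M * `|h|.
Proof.
move=> H; have := @mean_value01 (fun u => g (a + u * h)) (M * `|h|).
rewrite mul1r mul0r addr0; apply=> t /H[d gd dM].
exists (d * cplx h 0); first exact: has_vderiv_affine.
by rewrite cmodM cmod_real ler_wpM2r.
Qed.

Lemma deriv0_constant f (z w : C) :
  (forall t, 0 <= t <= 1 -> has_deriv f (z + cplx t 0 * (w - z)) 0) -> f w = f z.
Proof.
move=> H; apply/eqP; rewrite -subr_eq0; apply/eqP/cmod0_eq0.
have := @mean_value01 (fun u => f (z + cplx u 0 * (w - z))) 0.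
have -> : z + cplx 1 0 * (w - z) = w by rewrite -[cplx 1 0]/(1 : C); ring.
have -> : z + cplx 0 0 * (w - z) = z by rewrite -[cplx 0 0]/(0 : C); ring.
apply=> t /H h; exists 0; last by rewrite -[0 : C]/(cplx 0 0) cmod_real normr0.
by have := has_vderiv_line h; rewrite mul0r.
Qed.

End Complex.

(** * Goursat's theorem and local primitives *)

Section Goursat.
Variable R : realType.
Local Notation C := (CC R).

(** The integral from [A] has derivative [g x] at each point strictly to the right of [A], by the
    fundamental theorem of calculus. *)
Lemma antiderivative_real (g : R -> R) (A : R) : continuous g ->
  exists G : R -> R, forall x, A < x -> is_derive x (1 : R) G (g x).
Proof.
move=> cg.
exists (fun x => \int[lebesgue_measure]_(t in [set` `[A, x]]) g t)%R => x Ax.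
have [||||dF F'] := @continuous_FTC1 R g (BLeft A) x (x + 1).
- by rewrite ltrDl.
- apply: continuous_compact_integrable; first exact: segment_compact.
  exact: continuous_subspaceT.
- by rewrite lte_fin.
- exact: cg.
by rewrite -F' derive1E; apply/derivableP.
Qed.

Lemma antiderivative (g : R -> C) (A : R) :
  (forall t e : R, 0 < e -> exists2 r : R, 0 < r &
     forall u, `|u - t| < r -> cmod (g u - g t) < e) ->
  exists G : R -> C, forall t, A < t -> has_vderiv G t (g t).
Proof.
move=> cg.
have cont (p : C -> R) : (forall z w, p (z - w) = p z - p w) ->
    (forall z, `|p z| <= cmod z) -> continuous (p \o g).
  move=> pB pm t; apply/cvgrPdist_lt => e e0; have [r r0 rP] := cg t e e0.
  apply/nbhs_ballP; exists r => // u ut; have {}ut : `|t - u| < r by [].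
  suff : `|p (g t) - p (g u)| < e by [].
  rewrite distrC -pB; apply: le_lt_trans (pm _) _; apply: rP.
  by rewrite distrC.
have [|G1 G1P] := @antiderivative_real (@complex.Re R \o g) A.
  by apply: cont; [move=> [? ?] [? ?] | exact: cmod_re].
have [|G2 G2P] := @antiderivative_real (@complex.Im R \o g) A.
  by apply: cont; [move=> [? ?] [? ?] | exact: cmod_im].
exists (fun t => cplx (G1 t) (G2 t)) => t At e e0.
have e20 : 0 < e / 2 by rewrite divr_gt0.
have /is_derive_epsP/(_ _ e20)[r1 r10 r1P] := G1P t At.
have /is_derive_epsP/(_ _ e20)[r2 r20 r2P] := G2P t At.
exists (Num.min r1 r2); first by rewrite lt_min r10.
move=> u; rewrite lt_min => /andP[/r1P h1 /r2P h2].
move: h1 h2; rewrite /=; case: (g t) => a b /= h1 h2.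
rewrite [X in cmod X](_ : _ = cplx (G1 u - G1 t - a * (u - t)) (G2 u - G2 t - b * (u - t))).
  apply: le_trans (cmod_le _ _) _; apply: le_trans (lerD h1 h2) _.
  by rewrite -mulrDl -splitr.
by apply/eqP; rewrite eq_complex /= !mulr0 subr0 add0r !eqxx.
Qed.

Lemma has_vderivB (f g : R -> C) t c d : has_vderiv f t c -> has_vderiv g t d ->
  has_vderiv (fun u => f u - g u) t (c - d).
Proof.
move=> fc gd e e0; have e20 : 0 < e / 2 by rewrite divr_gt0.
have [r1 r10 r1P] := fc _ e20; have [r2 r20 r2P] := gd _ e20.
exists (Num.min r1 r2); first by rewrite lt_min r10.
move=> u; rewrite lt_min => /andP[/r1P h1 /r2P h2].
rewrite [X in cmod X](_ : _ = f u - f t - c * cplx (u - t) 0 -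
  (g u - g t - d * cplx (u - t) 0)); last by ring.
apply: le_trans (cmodD _ _) _; rewrite cmodN.
by apply: le_trans (lerD h1 h2) _; rewrite -mulrDl -splitr.
Qed.

(** This quadratic is a primitive of the affine approximation a + d (u - z0), the part of the
    integrand that Goursat's argument subtracts. *)
Lemma has_deriv_quadratic (a d z0 z : C) :
  has_deriv (fun u => a * u + d * (u ^+ 2 / 2 - z0 * u)) z (a + d * (z - z0)).
Proof.
move=> e e0; have k0 : 0 < cmod (d / 2) + 1 by rewrite ltr_wpDl // cmod_ge0.
exists (e / (cmod (d / 2) + 1)); first by rewrite divr_gt0.
move=> w; rewrite ltr_pdivlMr // => we.
rewrite [X in cmod X](_ : _ = d / 2 * (w - z) * (w - z)); last by field.
rewrite !cmodM ler_wpM2r ?cmod_ge0 // -cmodM mulrC.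
apply/ltW; apply: le_lt_trans we; rewrite cmodM.
by rewrite ler_wpM2l ?cmod_ge0 // lerDl.
Qed.

(** Along an edge in direction [v], [G] minus the primitive [F] of the affine approximation has
    derivative (f u - al - d (u - z0)) v, so the mean value inequality applies. *)
Lemma goursat_edge (f : C -> C) (G : R -> C) (z0 al d z v : C) (a h M : R) :
  let F u := al * u + d * (u ^+ 2 / 2 - z0 * u) in
  cmod v <= 1 ->
  (forall t, 0 <= t <= 1 -> let u := z + cplx (a + t * h) 0 * v in
     has_vderiv G (a + t * h) (f u * v) /\
     cmod (f u - al - d * (u - z0)) <= M) ->
  cmod (G (a + h) - G a - (F (z + cplx (a + h) 0 * v) - F (z + cplx a 0 * v)))
    <= M * `|h|.
Proof.
move=> F v1 H.
pose g t := G t - F (z + cplx t 0 * v).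
rewrite [X in cmod X](_ : _ = g (a + h) - g a); last by rewrite /g; ring.
apply: mean_value => t /H[Gt fM].
exists (f (z + cplx (a + t * h) 0 * v) * v -
  (al + d * (z + cplx (a + t * h) 0 * v - z0)) * v).
  apply: has_vderivB Gt _; apply: (@has_vderiv_line R F).
  exact: has_deriv_quadratic.
rewrite -mulrBl opprD addrA cmodM; apply: le_trans fM.
by rewrite ler_piMr // cmod_ge0.
Qed.

(* X y is meant to be a primitive of x |-> f (x + i y), and Y x one of
   y |-> i f (x + i y). *)
Definition rect_integral (X Y : R -> R -> C) (a b w h : R) : C :=
  X b (a + w) - X b a + (Y (a + w) (b + h) - Y (a + w) b)
  - (X (b + h) (a + w) - X (b + h) a) - (Y a (b + h) - Y a b).

(** The rectangle integral is additive over the four quarters. Near a point of differentiability the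
    affine part of [f] integrates to zero and the remainder is at most e l^2, a bound that is also
    additive under quartering. *)
Lemma goursat (f : C -> C) (X Y : R -> R -> C) (a b w h : R) :
  (forall s t, 0 <= s <= 1 -> 0 <= t <= 1 ->
     let x := a + s * w in let y := b + t * h in
     [/\ exists d, has_deriv f (cplx x y) d,
         has_vderiv (X y) x (f (cplx x y)) &
         has_vderiv (Y x) y (f (cplx x y) * cplx 0 1)]) ->
  rect_integral X Y a b w h = 0.
Proof.
move=> H; apply: cmod0_eq0; apply/ler_addgt0Pr => e e0; rewrite add0r.
have := @bisection R (fun s t l =>
  cmod (rect_integral X Y (a + s * w) (b + t * h) (l * w) (l * h)) <= e * l ^+ 2).
rewrite !mul0r !addr0 !mul1r expr1n mulr1; apply.
  move=> s t l l0 s0 s1 t0 t1 h1 h2 h3 h4.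
  have := le_trans (cmodD _ _) (lerD (le_trans (cmodD _ _) (lerD h1 h2))
     (le_trans (cmodD _ _) (lerD h3 h4))).
  rewrite [X in _ <= X -> _](_ : _ = e * l ^+ 2); last by field.
  congr (cmod _ <= _); rewrite /rect_integral.
  have E1 : a + (s + l / 2) * w + l / 2 * w = a + s * w + l * w by field.
  have E2 : b + (t + l / 2) * h + l / 2 * h = b + t * h + l * h by field.
  have E3 : a + (s + l / 2) * w = a + s * w + l / 2 * w by ring.
  have E4 : b + (t + l / 2) * h = b + t * h + l / 2 * h by ring.
  by rewrite E1 E2 E3 E4; ring.
move=> s t s01 t01; have [[d fd] _ _] := H s t s01 t01.
set z0 := cplx (a + s * w) (b + t * h) in fd.
pose W := `|w| + `|h|; have W0 : 0 <= W by rewrite addr_ge0.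
(* The four edges have total length 2 l W and the remainder on them is at most a tolerance times l
   W, whence the factor 2 W^2. Adding 1 covers degenerate rectangles. *)
have k0 : 0 < 2 * W ^+ 2 + 1 by rewrite ltr_wpDl // mulr_ge0 // exprn_ge0.
have W10 : 0 < W + 1 by rewrite ltr_wpDl.
have [|r r0 rP] := fd (e / (2 * W ^+ 2 + 1)); first by rewrite divr_gt0.
exists (r / (W + 1)); first by rewrite divr_gt0.
move=> s' t' l l0; rewrite ltr_pdivlMr // => lr s0 s1 t0 t1 /andP[s2 s3] /andP[t2 t3].
set M := e / (2 * W ^+ 2 + 1) * (l * W).
have fM (u v : R) : 0 <= u <= 1 -> 0 <= v <= 1 ->
   forall x y, x = a + s' * w + u * (l * w) -> y = b + t' * h + v * (l * h) ->
   cmod (f (cplx x y) - f z0 - d * (cplx x y - z0)) <= M.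
  move=> u01 v01 x y xE yE.
  have xyW : cmod (cplx x y - z0) <= l * W.
    have -> : cplx x y - z0 = cplx ((s' + u * l - s) * w) ((t' + v * l - t) * h).
      by apply/eqP; rewrite eq_complex /= xE yE; apply/andP; split; apply/eqP; ring.
    apply: le_trans (cmod_le _ _) _; rewrite !normrM mulrDr.
    by apply: lerD; rewrite ler_wpM2r // ler_norml; apply/andP; split; nra.
  have xyr : cmod (cplx x y - z0) < r.
    by apply: le_lt_trans xyW _; apply: le_lt_trans lr; rewrite ler_wpM2l ?lerDl // ltW.
  by apply: le_trans (rP _ xyr) _; rewrite ler_wpM2l // divr_ge0 ?(ltW e0) ?(ltW k0).
have HX (u v : R) : 0 <= u <= 1 -> 0 <= v <= 1 ->
   let x := a + s' * w + u * (l * w) in let y := b + t' * h + v * (l * h) in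
   has_vderiv (X y) x (f (cplx x y)) /\ has_vderiv (Y x) y (f (cplx x y) * cplx 0 1).
  move=> u01 v01 x y.
  have -> : x = a + (s' + u * l) * w by rewrite /x; ring.
  have -> : y = b + (t' + v * l) * h by rewrite /y; ring.
  have su : 0 <= s' + u * l <= 1 by apply/andP; split; nra.
  have tv : 0 <= t' + v * l <= 1 by apply/andP; split; nra.
  by have [_ ? ?] := H _ _ su tv.
set F := fun u => f z0 * u + d * (u ^+ 2 / 2 - z0 * u).
have cx (x y : R) : cplx x y = cplx 0 y + cplx x 0 * 1.
  by apply/eqP; rewrite eq_complex /= ?(mulr1, mulr0, mul0r, addr0, add0r, subr0) !eqxx.
have cy (x y : R) : cplx x y = cplx x 0 + cplx y 0 * cplx 0 1.
  by apply/eqP; rewrite eq_complex /= ?(mulr1, mulr0, mul0r, addr0, add0r, subr0) !eqxx.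
have c1 : cmod (1 : C) <= 1 by rewrite (cmod_real (1 : R)) normr1.
have ci : cmod (cplx 0 1 : C) <= 1 by rewrite cmod_i.
have EX (v : R) y x : 0 <= v <= 1 -> y = b + t' * h + v * (l * h) ->
  x = a + s' * w ->
  cmod (X y (x + l * w) - X y x - (F (cplx (x + l * w) y) - F (cplx x y)))
    <= M * `|l * w|.
  move=> v01 yE xE; rewrite (cx (x + _)) (cx x).
  apply: (goursat_edge (f := f)) c1 _ => u u01 /=; rewrite -cx mulr1.
  by split; [rewrite xE yE; exact: (HX u v u01 v01).1 | apply: (fM u v) => //; rewrite xE].
have EY (u : R) x y : 0 <= u <= 1 -> x = a + s' * w + u * (l * w) ->
  y = b + t' * h ->
  cmod (Y x (y + l * h) - Y x y - (F (cplx x (y + l * h)) - F (cplx x y)))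
    <= M * `|l * h|.
  move=> u01 xE yE; rewrite (cy _ (y + _)) (cy _ y).
  apply: (goursat_edge (f := f)) ci _ => v v01 /=; rewrite -cy.
  by split; [rewrite xE yE; exact: (HX u v u01 v01).2 | apply: (fM u v) => //; rewrite yE].
have i0 : 0 <= (0 : R) <= 1 by rewrite lexx ler01.
have i1 : 0 <= (1 : R) <= 1 by rewrite lexx ler01.
set x := a + s' * w; set y := b + t' * h.
have X0 := EX 0 y x i0 _ erefl; have X1 := EX 1 (y + l * h) x i1 _ erefl.
have Y0 := EY 0 x y i0 _ erefl; have Y1 := EY 1 (x + l * w) y i1 _ erefl.
move: X0 X1 Y0 Y1; rewrite !mul0r !mul1r !addr0; clearbody F.
move=> /(_ erefl) X0 /(_ erefl) X1 /(_ erefl) Y0 /(_ erefl) Y1.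
rewrite /rect_integral.
(* The values of [F] at the four corners cancel around the rectangle. *)
rewrite [X in cmod X](_ : _ =
 (X y (x + l * w) - X y x - (F (cplx (x + l * w) y) - F (cplx x y))) +
 (Y (x + l * w) (y + l * h) - Y (x + l * w) y
  - (F (cplx (x + l * w) (y + l * h)) - F (cplx (x + l * w) y)))
 + - (X (y + l * h) (x + l * w) - X (y + l * h) x
  - (F (cplx (x + l * w) (y + l * h)) - F (cplx x (y + l * h))))
 + - (Y x (y + l * h) - Y x y - (F (cplx x (y + l * h)) - F (cplx x y)))); last by ring.
move: X1 Y0; rewrite -cmodN => X1; rewrite -cmodN => Y0.
have := le_trans (cmodD _ _) (lerD (le_trans (cmodD _ _)
  (lerD (le_trans (cmodD _ _) (lerD X0 Y1)) X1)) Y0).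
move=> /le_trans; apply.
rewrite !normrM (ger0_norm (ltW l0)).
have -> : M * (l * `|w|) + M * (l * `|h|) + M * (l * `|w|) + M * (l * `|h|) =
   e * l ^+ 2 * ((2 * W ^+ 2) / (2 * W ^+ 2 + 1)).
  by rewrite /M /W; field; rewrite gt_eqF.
rewrite ler_piMr // ?mulr_ge0 ?exprn_ge0 ?(ltW e0) ?(ltW l0) //.
by rewrite ler_pdivrMr // mul1r lerDl.
Qed.

End Goursat.

(** * Primitives of a holomorphic function on a disc *)

Section LocalPrimitive.
Variable R : realType.
Local Notation C := (CC R).

Definition clamp (c r x : R) : R := Num.max (c - r) (Num.min x (c + r)).

Lemma clamp_id c r x : `|x - c| <= r -> clamp c r x = x.
Proof.
rewrite ler_norml => /andP[h1 h2]; rewrite /clamp.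
by rewrite min_l ?max_r //; lra.
Qed.

Lemma clamp_in c r x : 0 <= r -> `|clamp c r x - c| <= r.
Proof.
move=> r0; rewrite ler_norml /clamp; apply/andP; split.
  by have : c - r <= Num.max (c - r) (Num.min x (c + r)) by [rewrite le_max lexx]; lra.
have : Num.max (c - r) (Num.min x (c + r)) <= c + r.
  by rewrite ge_max ge_min lexx orbT andbT; lra.
lra.
Qed.

Lemma clamp_lip c r x y : 0 <= r -> `|clamp c r x - clamp c r y| <= `|x - y|.
Proof.
move=> r0; have h := ler_norm (x - y); have h' := ler_norm (y - x).
rewrite distrC in h'; rewrite ler_norml /clamp !maxEle !minEle.
case: (leP x (c + r)) => ?; case: (leP y (c + r)) => ?;
  case: (leP (c - r) x) => ?; case: (leP (c - r) y) => ?;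
  case: (leP (c - r) (c + r)) => ?; apply/andP; split; lra.
Qed.

(** The primitive integrates [f] horizontally at height [y0], then vertically. Goursat's theorem
    moves the horizontal increment to the height of the point considered, and continuity of [f]
    gives the derivative. *)
Lemma local_primitive (f : C -> C) (z0 : C) (r : R) : 0 < r ->
  (forall z, cmod (z - z0) < r -> exists d, has_deriv f z d) ->
  exists F : C -> C, forall z, cmod (z - z0) < r / 4 -> has_deriv F z (f z).
Proof.
move=> r0 fd; case: z0 fd => x0 y0 fd.
set z0 : C := Complex x0 y0 in fd *.
(* In the square of half-side [p], both coordinates differ from those of the centre by at most r/4,
   so its points lie at distance at most r/2 < r. *)
pose p := r / 4; have p0 : 0 < p by rewrite divr_gt0.
(* Clamping to a closed square inside the disc makes f continuous everywhere, so
   that antiderivatives along all horizontal and vertical lines exist. *)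
pose cl (x y : R) := cplx (clamp x0 p x) (clamp y0 p y).
have clr x y : cmod (cl x y - z0) < r.
  have -> : cl x y - z0 = cplx (clamp x0 p x - x0) (clamp y0 p y - y0) by [].
  have h1 := clamp_in x0 x (ltW p0); have h2 := clamp_in y0 y (ltW p0).
  by apply: le_lt_trans (cmod_le _ _) _; apply: le_lt_trans (lerD h1 h2) _; rewrite /p; lra.
have cl_lip x y x' y' : cmod (cl x y - cl x' y') <= `|x - x'| + `|y - y'|.
  have -> : cl x y - cl x' y' = cplx (clamp x0 p x - clamp x0 p x')
     (clamp y0 p y - clamp y0 p y') by [].
  by apply: le_trans (cmod_le _ _) _; rewrite lerD // clamp_lip // ltW.
have cl_id x y : `|x - x0| <= p -> `|y - y0| <= p -> cl x y = cplx x y.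
  by move=> hx hy; rewrite /cl !clamp_id.
have cont (x y e : R) : 0 < e -> exists2 q : R, 0 < q & forall x' y',
    `|x' - x| + `|y' - y| < q -> cmod (f (cl x' y') - f (cl x y)) < e.
  move=> e0; have [d /has_deriv_cont/(_ e e0)[q q0 qP]] := fd _ (clr x y).
  exists q => // x' y' h; apply: qP; exact: le_lt_trans (cl_lip _ _ _ _) h.
have /choice[X XP] y : exists G : R -> C, forall x, x0 - r < x ->
    has_vderiv G x (f (cl x y)).
  apply: antiderivative => t e /(cont t y)[q q0 qP]; exists q => // u ut.
  by apply: qP; rewrite subrr normr0 addr0.
have /choice[Y YP] x : exists G : R -> C, forall y, y0 - r < y ->
    has_vderiv G y (f (cl x y) * cplx 0 1).
  apply: antiderivative => t e /(cont x t)[q q0 qP]; exists q => // u ut.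
  by rewrite -mulrBl cmodM cmod_i mulr1; apply: qP; rewrite subrr normr0 add0r.
have XP' x y : `|x - x0| <= p -> `|y - y0| <= p -> has_vderiv (X y) x (f (cplx x y)).
  move=> hx hy; rewrite -cl_id //; apply: XP.
  by move: hx; rewrite ler_norml /p => /andP[]; lra.
have YP' x y : `|x - x0| <= p -> `|y - y0| <= p ->
    has_vderiv (Y x) y (f (cplx x y) * cplx 0 1).
  move=> hx hy; rewrite -cl_id //; apply: YP.
  by move: hy; rewrite ler_norml /p => /andP[]; lra.
have conv (c a w s : R) : `|a - c| <= p -> `|a + w - c| <= p -> 0 <= s <= 1 ->
    `|a + s * w - c| <= p.
  rewrite !ler_norml => /andP[? ?] /andP[? ?] /andP[? ?].
  by apply/andP; split; nra.
pose F (z : C) := X y0 (complex.Re z) + Y (complex.Re z) (complex.Im z) -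
  Y (complex.Re z) y0.
exists F; case=> x y zp e e0.
have [xp yp] : `|x - x0| < p /\ `|y - y0| < p.
  have h1 := cmod_re (Complex x y - z0); have h2 := cmod_im (Complex x y - z0).
  by split; [apply: le_lt_trans h1 _ | apply: le_lt_trans h2 _].
have e20 : 0 < e / 2 by rewrite divr_gt0.
have [q q0 qP] := cont x y _ e20.
(* The sum of the coordinate increments is at most twice the modulus, hence q/2 here and e/2 as
   tolerance. The second bound keeps the new point in the disc. *)
exists (Num.min (q / 2) (p - cmod (Complex x y - z0))).
  by rewrite lt_min divr_gt0 // subr_gt0.
case=> x' y'; rewrite lt_min ltrBrDr => /andP[uq up].
set z : C := Complex x y in zp uq up *; set u : C := Complex x' y' in uq up *.
have [xp' yp'] : `|x' - x0| < p /\ `|y' - y0| < p.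
  have h : cmod (u - z0) < p.
    apply: le_lt_trans up; apply: le_trans (cmodD _ _).
    by rewrite addrA subrK.
  have h1 := cmod_re (u - z0); have h2 := cmod_im (u - z0).
  by split; [apply: le_lt_trans h1 _ | apply: le_lt_trans h2 _].
have hx := cmod_re (u - z); have hy := cmod_im (u - z).
rewrite /= in hx hy.
have y00 : `|y0 - y0| <= p by rewrite subrr normr0 ltW.
have G : rect_integral X Y x y0 (x' - x) (y - y0) = 0.
  apply: (@goursat R f) => s t s01 t01 /=.
  have hs : `|x + s * (x' - x) - x0| <= p by apply: conv => //; rewrite ?subrKC ltW.
  have ht : `|y0 + t * (y - y0) - y0| <= p by apply: conv => //; rewrite ?subrKC ltW.
  split; last by apply: YP'.
    by rewrite -(cl_id _ _ hs ht); exact: fd (clr _ _).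
  by apply: XP'.
have E : F u - F z = (X y x' - X y x) + (Y x' y' - Y x' y).
  move: G; rewrite /rect_integral !subrKC /F /= => G.
  by apply/eqP; rewrite -subr_eq0 -[X in _ == X]G; apply/eqP; ring.
(* Subtracting the constant value [f z] leaves curves whose derivatives are at most e/2, to which
   the mean value inequality applies. *)
pose gX t := X y t - f z * cplx t 0 * 1.
pose gY t := Y x' t - f z * cplx t 0 * cplx 0 1.
have lin (c v : C) t : has_vderiv (fun t => c * cplx t 0 * v) t (c * v).
  move=> e1 e10; exists 1; first exact: ltr01.
  move=> s _; have -> : cplx (s - t) 0 = cplx s 0 - cplx t 0.
    by apply/eqP; rewrite eq_complex /= subr0 !eqxx.
  rewrite [X in cmod X](_ : _ = 0); last by ring.
  by rewrite (cmod_real (0 : R)) normr0 mulr_ge0 // ltW.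
have fz : f z = f (cl x y) by rewrite cl_id ?ltW.
have BX : cmod (gX (x + (x' - x)) - gX x) <= e / 2 * `|x' - x|.
  apply: mean_value => s s01.
  have hs : `|x + s * (x' - x) - x0| <= p by apply: conv => //; rewrite ?subrKC ltW.
  exists (f (cplx (x + s * (x' - x)) y) - f z * 1).
    by apply: has_vderivB (lin _ _ _); apply: XP' => //; exact: ltW.
  rewrite mulr1 fz -cl_id ?(ltW yp) //; apply: ltW; apply: qP; rewrite subrr normr0 addr0.
  rewrite addrAC subrr add0r normrM; move: s01 => /andP[s0 s1].
  rewrite ger0_norm //; have := normr_ge0 (x' - x); nra.
have BY : cmod (gY (y + (y' - y)) - gY y) <= e / 2 * `|y' - y|.
  apply: mean_value => s s01.
  have hs : `|y + s * (y' - y) - y0| <= p by apply: conv => //; rewrite ?subrKC ltW.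
  exists (f (cplx x' (y + s * (y' - y))) * cplx 0 1 - f z * cplx 0 1).
    by apply: has_vderivB (lin _ _ _); apply: YP' => //; exact: ltW.
  rewrite -mulrBl cmodM cmod_i mulr1.
  rewrite fz -cl_id ?(ltW xp') //; apply: ltW; apply: qP.
  rewrite [y + _ - y]addrAC subrr add0r normrM; move: s01 => /andP[s0 s1].
  rewrite (ger0_norm s0); have := normr_ge0 (y' - y); nra.
have -> : F u - F z - f z * (u - z) =
    (gX (x + (x' - x)) - gX x) + (gY (y + (y' - y)) - gY y).
  rewrite E !subrKC /gX /gY.
  have -> : u - z = cplx x' 0 - cplx x 0 + (cplx y' 0 - cplx y 0) * cplx 0 1.
    by apply/eqP; rewrite eq_complex /=; apply/andP; split; apply/eqP; ring.
  by ring.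
apply: le_trans (cmodD _ _) _; apply: le_trans (lerD BX BY) _.
by nra.
Qed.

End LocalPrimitive.

(** * Continuation over the unit square *)

Section Continuation.
Variables (R : realType) (V : zmodType).
Implicit Types (D : R -> R -> bool) (p g : R -> R -> V).

(** Neighbourhoods are relative to [D] because closed boxes are glued along edges: at a common edge
    each box sees only its own side. *)
Definition near_in D (s t : R) (Q : R -> R -> Prop) := exists2 d : R, 0 < d &
  forall s' t', D s' t' -> `|s' - s| < d -> `|t' - t| < d -> Q s' t'.

Lemma near_inI D s t (Q1 Q2 : R -> R -> Prop) :
  near_in D s t Q1 -> near_in D s t Q2 ->
  near_in D s t (fun s' t' => Q1 s' t' /\ Q2 s' t').
Proof.
move=> [d1 d10 h1] [d2 d20 h2]; exists (Num.min d1 d2); first by rewrite lt_min d10.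
by move=> s' t' D' ; rewrite !lt_min => /andP[? ?] /andP[? ?]; split; [apply: h1|apply: h2].
Qed.

Lemma near_inS D D' s t (Q Q' : R -> R -> Prop) :
  (forall s' t', D' s' t' -> Q s' t' -> D s' t' -> Q' s' t') ->
  (forall s' t', D' s' t' -> D s' t') ->
  near_in D s t Q -> near_in D' s t Q'.
Proof.
move=> QQ DD [d d0 h]; exists d => // s' t' D1 hs ht.
by apply: QQ => //; [apply: h => //; exact: DD | exact: DD].
Qed.

Definition box (a b w h s t : R) := (a <= s <= a + w) && (b <= t <= b + h).

Definition convex_dom D := forall s t s' t' x, D s t -> D s' t' -> 0 <= x <= 1 ->
  D (s + x * (s' - s)) (t + x * (t' - t)).

Lemma box_convex a b w h : convex_dom (box a b w h).
Proof.
move=> s t s' t' x /andP[/andP[? ?] /andP[? ?]] /andP[/andP[? ?] /andP[? ?]] /andP[? ?].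
by rewrite /box; apply/andP; split; apply/andP; split; nra.
Qed.

(** Restricting [k] to the segment joining the two points reduces this to bisection of [0, 1]. *)
Lemma locally_constant D (k : R -> R -> V) : convex_dom D ->
  (forall s t, D s t -> near_in D s t (fun s' t' => k s' t' = k s t)) ->
  forall s t s' t', D s t -> D s' t' -> k s t = k s' t'.
Proof.
move=> cD kloc s t s' t' Dst Dst'.
pose u x := k (s + x * (s' - s)) (t + x * (t' - t)).
suff : u 0 = u (0 + 1) by rewrite /u add0r !mul0r !addr0 !mul1r !subrKC.
apply: (@bisection1 R (fun x l => u x = u (x + l))).
  by move=> x l _ _ _ -> ->; rewrite -addrA -splitr.
move=> x x01; have [d d0 dP] := kloc _ _ (cD _ _ _ _ _ Dst Dst' x01).
(* [M] bounds the speed of the segment in both coordinates; the summand 1 keeps it positive when the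
   end points coincide. *)
pose M := `|s' - s| + `|t' - t| + 1.
have M0 : 0 < M by rewrite ltr_wpDl // addr_ge0.
exists (d / M) => [|y l l0]; first by rewrite divr_gt0.
rewrite ltr_pdivlMr // => lM y0 y1 /andP[y2 y3].
have near z : 0 <= z <= 1 -> `|z - x| <= l -> u z = u x.
  move=> z01 zx; apply: dP; first exact: cD.
    rewrite opprD addrACA subrr add0r -mulrBl normrM.
    have := normr_ge0 (s' - s); have := normr_ge0 (t' - t); rewrite /M in lM; nra.
  rewrite opprD addrACA subrr add0r -mulrBl normrM.
  have := normr_ge0 (s' - s); have := normr_ge0 (t' - t); rewrite /M in lM; nra.
by rewrite !near // ?ler_norml; apply/andP; split; lra.
Qed.

(* P s t p means that p is an admissible local section at (s, t); such sections
   are unique near (s, t) up to an additive constant. *)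
Variable P : R -> R -> (R -> R -> V) -> Prop.
Let I : R -> R -> bool := box 0 0 1 1.

Definition section D g := forall s t, D s t -> exists2 p, P s t p &
  near_in D s t (fun s' t' => g s' t' = p s' t').

Hypothesis P_ex : forall s t, I s t -> exists p, near_in I s t (fun s' t' => P s' t' p).
Hypothesis P_uniq : forall s t p p', I s t -> P s t p -> P s t p' ->
  near_in I s t (fun s' t' => p' s' t' - p s' t' = p' s t - p s t).
Hypothesis P_add : forall s t p c, P s t p -> P s t (fun s' t' => p s' t' + c).

Lemma sectionS D D' g : (forall s t, D' s t -> D s t) -> section D g -> section D' g.
Proof.
move=> DD h s t D1; have [p Pp np] := h s t (DD _ _ D1); exists p => //.
by apply: near_inS np.
Qed.

Definition closed_dom D := forall s t, ~~ D s t ->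
  near_in (fun _ _ => true) s t (fun s' t' => ~~ D s' t').

Lemma box_closed a b w h : closed_dom (box a b w h).
Proof.
move=> s t; rewrite /box => /nandP[/nandP[]|/nandP[]]; rewrite -ltNge => h1.
- exists (a - s) => [|s' t' _]; first by rewrite subr_gt0.
  rewrite ltr_norml => /andP[_ hs] _; apply/nandP; left; apply/nandP; left.
  by rewrite -ltNge; lra.
- exists (s - (a + w)) => [|s' t' _]; first by rewrite subr_gt0.
  rewrite ltr_norml => /andP[hs _] _; apply/nandP; left; apply/nandP; right.
  by rewrite -ltNge; lra.
- exists (b - t) => [|s' t' _ _]; first by rewrite subr_gt0.
  rewrite ltr_norml => /andP[_ hs]; apply/nandP; right; apply/nandP; left.
  by rewrite -ltNge; lra.
- exists (t - (b + h)) => [|s' t' _ _]; first by rewrite subr_gt0.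
  rewrite ltr_norml => /andP[hs _]; apply/nandP; right; apply/nandP; right.
  by rewrite -ltNge; lra.
Qed.

(** The difference of the two sections is locally constant on the convex overlap, hence a constant
    [c]. Subtracting [c] from the second makes them agree there. *)
Lemma section_glue D1 D2 g1 g2 :
  (forall s t, D1 s t -> I s t) -> (forall s t, D2 s t -> I s t) ->
  closed_dom D1 -> closed_dom D2 -> convex_dom D1 -> convex_dom D2 ->
  section D1 g1 -> section D2 g2 ->
  exists g, section (fun s t => D1 s t || D2 s t) g.
Proof.
move=> I1 I2 cl1 cl2 cv1 cv2 S1 S2.
pose D12 s t := D1 s t && D2 s t.
have loc s t : D12 s t -> near_in D12 s t
    (fun s' t' => g2 s' t' - g1 s' t' = g2 s t - g1 s t).
  move=> /andP[d1 d2]; have [p1 P1 n1] := S1 _ _ d1; have [p2 P2 n2] := S2 _ _ d2.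
  have E : g2 s t - g1 s t = p2 s t - p1 s t.
    have [r1 r10 /(_ s t d1)->] := n1; rewrite ?subrr ?normr0 //.
    by have [r2 r20 /(_ s t d2)->] := n2; rewrite ?subrr ?normr0.
  have n := P_uniq (I1 _ _ d1) P1 P2.
  have {}n1 : near_in D12 s t (fun s' t' => g1 s' t' = p1 s' t').
    by apply: near_inS n1 => // s' t' /andP[].
  have {}n2 : near_in D12 s t (fun s' t' => g2 s' t' = p2 s' t').
    by apply: near_inS n2 => // s' t' /andP[].
  have {}n : near_in D12 s t (fun s' t' => p2 s' t' - p1 s' t' = p2 s t - p1 s t).
    by apply: near_inS n => // s' t' /andP[/I1].
  apply: near_inS (near_inI n (near_inI n1 n2)) => // s' t' _ [h [-> ->]] _.
  by rewrite h E.
(* When the domains are disjoint any constant will do, and 0 is taken. *)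
have [c cP] : exists c, forall s t, D12 s t -> g2 s t - g1 s t = c.
  case: (pselect (exists z : R * R, D12 z.1 z.2)) => [[[s0 t0] /= d0]|no].
    exists (g2 s0 t0 - g1 s0 t0) => s t d.
    apply: (locally_constant (k := fun s t => g2 s t - g1 s t)) loc _ _ _ _ d d0.
    by move=> ? ? ? ? ? /andP[? ?] /andP[? ?] ?; apply/andP; split; [exact: cv1|exact: cv2].
  by exists 0 => s t d; case: no; exists (s, t).
exists (fun s t => if D1 s t then g1 s t else g2 s t - c) => s t.
have [d1 _|d1 /= d2] := boolP (D1 s t).
  have [p1 P1 n1] := S1 _ _ d1; exists p1 => //.
  have [d2|d2] := boolP (D2 s t); last first.
    (* Since [D2] is closed, nearby points of the union lie in [D1]. *)
    have [q q0 qP] := cl2 _ _ d2; have [r r0 rP] := n1.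
    exists (Num.min q r) => [|s' t' D']; first by rewrite lt_min q0.
    rewrite !lt_min => /andP[? ?] /andP[? ?].
    have h2 : ~~ D2 s' t' by apply: qP.
    by move: D'; rewrite (negPf h2) orbF => h1; rewrite h1; exact: rP.
  have [p2 P2 n2] := S2 _ _ d2.
  (* At a point of the overlap the germ [p2] shifted by [c] is the germ [p1], so [p1] serves on both
     sides. *)
  have E : p2 s t - p1 s t = c.
    rewrite -(cP s t) /D12 ?d1 ?d2 //.
    have [r1 r10 /(_ s t d1)->] := n1; rewrite ?subrr ?normr0 //.
    by have [r2 r20 /(_ s t d2)->] := n2; rewrite ?subrr ?normr0.
  have [r1 r10 h1] := n1; have [r2 r20 h2] := n2.
  have [r3 r30 h3] := P_uniq (I1 _ _ d1) P1 P2.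
  exists (Num.min r1 (Num.min r2 r3)) => [|s' t' D']; first by rewrite !lt_min r10 r20.
  rewrite !lt_min => /and3P[? ? ?] /and3P[? ? ?].
  have [k1|k1] := boolP (D1 s' t'); first exact: h1.
  move: D'; rewrite (negPf k1) /= => k2; rewrite h2 // -E -(h3 s' t') //; last exact: I2.
  by rewrite opprB subrKC.
have [p2 P2 n2] := S2 _ _ d2; exists (fun s t => p2 s t - c); first exact: P_add.
have [q q0 qP] := cl1 _ _ d1; have [r r0 rP] := n2.
exists (Num.min q r) => [|s' t' D']; first by rewrite lt_min q0.
rewrite !lt_min => /andP[? ?] /andP[? ?].
have h1 : ~~ D1 s' t' by apply: qP.
by move: D'; rewrite (negPf h1) /= => h2; rewrite rP.
Qed.

Lemma box_glue a b w h a' b' w' h' A B W H :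
  (forall s t, box a b w h s t -> I s t) -> (forall s t, box a' b' w' h' s t -> I s t) ->
  (forall s t, box A B W H s t -> box a b w h s t || box a' b' w' h' s t) ->
  (exists g, section (box a b w h) g) -> (exists g, section (box a' b' w' h') g) ->
  exists g, section (box A B W H) g.
Proof.
move=> I1 I2 sub [g1 S1] [g2 S2].
have [g Sg] := section_glue I1 I2 (@box_closed _ _ _ _) (@box_closed _ _ _ _)
  (@box_convex _ _ _ _) (@box_convex _ _ _ _) S1 S2.
by exists g; apply: sectionS Sg.
Qed.

(** Small squares carry a section by [P_ex]. Sections on the four quarters are glued in pairs along
    the first coordinate, and the two halves along the second. *)
Lemma continuation : exists g, section I g.
Proof.
apply: (@bisection R (fun s t l => exists g, section (box s t l l) g)).
  move=> s t l l0 s0 s1 t0 t1 h1 h2 h3 h4.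
  have bI a b w h : 0 <= a -> 0 <= b -> a + w <= 1 -> b + h <= 1 ->
      forall s t, box a b w h s t -> I s t.
    move=> a0 b0 a1 b1 x y /andP[/andP[? ?] /andP[? ?]]; rewrite /I /box.
    by apply/andP; split; apply/andP; split; lra.
  have k1 : exists g, section (box s t l (l / 2)) g.
    apply: box_glue h1 h2; [by apply: bI; lra | by apply: bI; lra |].
    move=> x y /andP[/andP[? ?] /andP[? ?]]; rewrite /box.
    by have [?|?] := leP x (s + l / 2); apply/orP; [left|right];
      apply/andP; split; apply/andP; split; lra.
  have k2 : exists g, section (box s (t + l / 2) l (l / 2)) g.
    apply: box_glue h3 h4; [by apply: bI; lra | by apply: bI; lra |].
    move=> x y /andP[/andP[? ?] /andP[? ?]]; rewrite /box.
    by have [?|?] := leP x (s + l / 2); apply/orP; [left|right];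
      apply/andP; split; apply/andP; split; lra.
  apply: box_glue k1 k2; [by apply: bI; lra | by apply: bI; lra |].
  move=> x y /andP[/andP[? ?] /andP[? ?]]; rewrite /box.
  by have [?|?] := leP y (t + l / 2); apply/orP; [left|right];
    apply/andP; split; apply/andP; split; lra.
move=> s t s01 t01; have [|p [d d0 dP]] := P_ex (s := s) (t := t).
  by rewrite /I /box !add0r s01.
exists d => // s' t' l l0 ld s0 s1 t0 t1 /andP[s2 s3] /andP[t2 t3].
exists p => x y /andP[/andP[x1 x2] /andP[y1 y2]]; exists p; last by exists 1.
apply: dP; last 2 first.
- by rewrite ltr_norml; apply/andP; split; lra.
- by rewrite ltr_norml; apply/andP; split; lra.
by rewrite /I /box; apply/andP; split; apply/andP; split; lra.
Qed.

End Continuation.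

(** * Primitives of forms on a Riemann surface *)

Section Forms.
Variables (R : realType) (S : riemannSurface R).
Local Notation C := (CC R).

Lemma has_deriv_comp (f g : C -> C) z d e :
  has_deriv f (g z) d -> has_deriv g z e -> has_deriv (f \o g) z (d * e).
Proof.
move=> fd ge x x0.
have k1 : 0 < 1 + cmod e by rewrite ltr_pwDl // cmod_ge0.
have k2 : 0 < 1 + cmod d by rewrite ltr_pwDl // cmod_ge0.
have : 0 < x / 2 by rewrite divr_gt0.
move: (x / 2) (splitr x) => y xE y0.
have [r1 r10 h1] := fd (y / (1 + cmod e)) (divr_gt0 y0 k1).
have [r2 r20 h2] := ge (y / (1 + cmod d)) (divr_gt0 y0 k2).
have [r3 r30 h3] := ge 1 ltr01.
exists (Num.min r2 (Num.min r3 (r1 / (1 + cmod e)))).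
  by rewrite !lt_min r20 r30 divr_gt0.
move=> w; rewrite !lt_min ltr_pdivlMr // => /and3P[/h2 {}h2 /h3 {}h3 wr1] /=.
have gw : cmod (g w - g z) <= cmod (w - z) * (1 + cmod e).
  have -> : g w - g z = (g w - g z - e * (w - z)) + e * (w - z) by ring.
  apply: le_trans (cmodD _ _) _; rewrite cmodM.
  by rewrite (mulrDr (cmod _)) mulr1 lerD ?(mulrC (cmod e)) // -[leRHS]mul1r.
have {}h1 := h1 _ (le_lt_trans gw wr1).
rewrite [X in cmod X](_ : _ = (f (g w) - f (g z) - d * (g w - g z)) +
   d * (g w - g z - e * (w - z))); last by ring.
apply: le_trans (cmodD _ _) _; rewrite xE (mulrDl y).
apply: lerD.
  apply: le_trans h1 _; rewrite mulrAC ler_pdivrMr // -mulrA.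
  by rewrite ler_wpM2l // ltW.
rewrite cmodM; apply: le_trans (ler_wpM2l (cmod_ge0 _) h2) _.
rewrite mulrA ler_wpM2r ?cmod_ge0 // mulrCA ler_piMr ?(ltW y0) //.
by rewrite ler_pdivrMr // mul1r lerDr.
Qed.

Lemma has_derivM (f g : C -> C) z d e : has_deriv f z d -> has_deriv g z e ->
  has_deriv (fun w => f w * g w) z (f z * e + g z * d).
Proof. by move=> /has_derivP fd /has_derivP ge; apply/has_derivP; exact: is_deriveM. Qed.

Lemma has_derivB (f g : C -> C) z d e : has_deriv f z d -> has_deriv g z e ->
  has_deriv (fun w => f w - g w) z (d - e).
Proof. by move=> /has_derivP fd /has_derivP ge; apply/has_derivP; exact: is_deriveB. Qed.

Lemma has_deriv_cst (c z : C) : has_deriv (fun=> c) z 0.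
Proof. by apply/has_derivP; exact: is_derive_cst. Qed.

Lemma derivable_has_deriv (f : C -> C) z :
  derivable f z (1 : C) <-> exists d, has_deriv f z d.
Proof.
split=> [/derivableP fd|[d /has_derivP fd]]; last exact: ex_derive.
by eexists; apply/has_derivP; exact: fd.
Qed.

Lemma nbhs_cmodP (z : C) (W : set C) :
  nbhs z W <-> exists2 r : R, 0 < r & forall w, cmod (w - z) < r -> W w.
Proof.
split=> [/nbhs_ballP[[r1 r2]]|[r r0 rW]].
  rewrite /= ltcE /= => /andP[/eqP -> r0] rW; exists r1 => // w wr; apply: rW.
  by rewrite -ball_normE /= distrC normE ltcE /= eqxx.
apply/nbhs_ballP; exists (cplx r 0); first by rewrite /= ltcE /= eqxx.
by move=> w; rewrite -ball_normE /= distrC normE ltcE /= eqxx /=; exact: rW.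
Qed.

Lemma chart_nbhs (f : chart R S) p (V : set S) : is_chart f -> chart_dom f p ->
  open V -> V p -> exists2 r : R, 0 < r & forall z, cmod (z - f p) < r ->
    [/\ chart_dom f (chart_inv f z), V (chart_inv f z) & f (chart_inv f z) = z].
Proof.
move=> [oD oI fK fc ic] fp oV Vp.
have /nbhs_cmodP[r1 r10 h1] : nbhs (f p) (f @` chart_dom f).
  by apply: open_nbhs_nbhs; split=> //; exists p.
have /nbhs_cmodP[r2 r20 h2] : nbhs (f p) (chart_inv f @^-1` V).
  by apply: ic => //; rewrite fK //; apply: open_nbhs_nbhs.
exists (Num.min r1 r2); first by rewrite lt_min r10.
move=> z; rewrite lt_min => /andP[/h1[q fq <-] /h2 Vz].
by split=> //; rewrite ?fK.
Qed.

Definition chart_disc (f : chart R S) p (r : R) : set S :=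
  [set q | chart_dom f q /\ cmod (f q - f p) < r].

Lemma chart_disc_open (f : chart R S) p r : is_chart f -> open (chart_disc f p r).
Proof.
move=> [oD oI fK fc ic]; rewrite openE => q [fq qr].
rewrite /interior; apply: filterI; first exact: open_nbhs_nbhs.
have : nbhs (f q) [set z | cmod (z - f p) < r].
  apply/nbhs_cmodP; exists (r - cmod (f q - f p)); first by rewrite subr_gt0.
  move=> w; rewrite ltrBrDr => /=; apply: le_lt_trans.
  by rewrite (_ : w - f p = (w - f q) + (f q - f p)) ?cmodD //; ring.
exact: fc.
Qed.

Lemma chart_disc_center (f : chart R S) p r :
  chart_dom f p -> 0 < r -> chart_disc f p r p.
Proof. by split=> //; rewrite subrr (cmod_real (0 : R)) normr0. Qed.

Definition compatible (theta : one_form S) := forall f g p, atlas S f -> atlas S g ->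
  chart_dom f p -> chart_dom g p ->
  theta f p = theta g p * 'D_1 (g \o chart_inv f) (f p).

Definition holomorphic_on (theta : one_form S) (V : set S) := forall f p,
  atlas S f -> chart_dom f p -> V p ->
  derivable (theta f \o chart_inv f) (f p) 1.

Lemma chartP f : atlas S f -> is_chart f.
Proof. exact: (atlas_chart (surface_atlas S)). Qed.

Lemma chart_at p : exists2 f : chart R S, atlas S f & chart_dom f p.
Proof. exact: (atlas_cover (surface_atlas S)). Qed.

(** A primitive found in one chart is a primitive in every other chart, by the transformation law of
    the form and the chain rule. *)
Lemma primitive_exists theta V p : compatible theta -> holomorphic_on theta V ->
  open V -> V p ->
  exists (U : set S) F, [/\ open U, U p, U `<=` V & primitive_on theta U F].
Proof.
move=> ct ht oV Vp; have [f Af fp] := chart_at p; have cf := chartP Af.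
have [oD oI fK fc ic] := cf.
have [r r0 rP] := chart_nbhs cf fp oV Vp.
have [|F FP] := @local_primitive R (theta f \o chart_inv f) (f p) r r0.
  move=> z /rP[dz Vz fz]; apply/derivable_has_deriv.
  by have := ht _ _ Af dz Vz; rewrite fz.
have r40 : 0 < r / 4 by rewrite divr_gt0.
exists (chart_disc f p (r / 4)), (F \o f); split.
- exact: chart_disc_open.
- exact: chart_disc_center.
- move=> q [fq qr]; have [|_ + _] := rP (f q); last by rewrite fK.
  by apply: lt_trans qr _; rewrite ltr_pdivrMr // ltr_pMr // ltr1n.
move=> g q Ag gq [fq qr]; apply/has_derivP.
rewrite (ct _ _ _ Ag Af gq fq) -compA; apply: has_deriv_comp.
  have := FP _ qr; rewrite /= fK //; congr has_deriv.
  by rewrite /= (let: And5 _ _ gK _ _ := chartP Ag in gK _ gq).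
apply/has_derivP/derivableP.
exact: (atlas_transition (surface_atlas S)).
Qed.

(** In a chart disc around [p] the difference of the primitives has derivative zero along each
    radius. *)
Lemma primitive_unique theta U U' F F' p : open U -> open U' -> U p -> U' p ->
  primitive_on theta U F -> primitive_on theta U' F' ->
  exists W : set S, [/\ open W, W p, W `<=` U `&` U' &
    forall q, W q -> F' q - F q = F' p - F p].
Proof.
move=> oU oU' Up Up' pF pF'; have [f Af fp] := chart_at p; have cf := chartP Af.
have [oD oI fK fc ic] := cf.
have [r r0 rP] := chart_nbhs cf fp (openI oU oU') (conj Up Up').
exists (chart_disc f p r); split.
- exact: chart_disc_open.
- exact: chart_disc_center.
- by move=> q [fq /rP[_ + _]]; rewrite fK.
move=> q [fq qr].
have := @deriv0_constant R (fun z => F' (chart_inv f z) - F (chart_inv f z)) (f p) (f q).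
rewrite !fK //; apply=> t t01.
have /rP[dz [Uz Uz'] fz] : cmod (f p + cplx t 0 * (f q - f p) - f p) < r.
  rewrite addrAC subrr add0r cmodM cmod_real; apply: le_lt_trans qr.
  by case/andP: t01 => t0 t1; rewrite ger0_norm // ler_piMl // cmod_ge0.
have /has_derivP h := pF _ _ Af dz Uz; have /has_derivP h' := pF' _ _ Af dz Uz'.
by have := has_derivB h' h; rewrite fz subrr.
Qed.

Lemma primitive_onS theta (U U' : set S) F : U' `<=` U ->
  primitive_on theta U F -> primitive_on theta U' F.
Proof. by move=> UU pF f p Af fp /UU; exact: pF. Qed.

Lemma primitive_on_addr theta (U : set S) F c :
  primitive_on theta U F -> primitive_on theta U (fun q => F q + c).
Proof.
move=> pF f p Af fp Up; have /has_derivP h := pF _ _ Af fp Up.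
have := has_derivB h (has_deriv_cst (- c) (f p)); rewrite subr0 => {}h.
by apply/has_derivP; move: h; congr has_deriv; apply/funext => z /=; rewrite opprK.
Qed.

(** For a local primitive [F] of omega this is the form F eta whose primitives define the iterated
    integral of omega and eta. *)
Definition form_mul (F : S -> C) (theta : one_form S) : one_form S :=
  fun f p => F p * theta f p.

Lemma compatible_mul F theta : compatible theta -> compatible (form_mul F theta).
Proof. by move=> ct f g p Af Ag fp gp; rewrite /form_mul (ct f g) // mulrA. Qed.

Lemma holomorphic_mul theta eta (U : set S) F : primitive_on theta U F ->
  holomorphic_on eta U -> holomorphic_on (form_mul F eta) U.
Proof.
move=> pF he f p Af fp Up; have /has_derivP h1 := pF _ _ Af fp Up.
have /derivable_has_deriv[d h2] := he _ _ Af fp Up.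
by apply/derivable_has_deriv; eexists; apply: has_derivM h1 h2.
Qed.

(** Equality of [F] and [F'] at [p] propagates to a neighbourhood. There [K] and [K'] are primitives
    of the same form, so they differ by a constant. *)
Lemma primitive_unique2 theta eta (U U' : set S) F F' K K' p :
  open U -> open U' -> U p -> U' p -> F p = F' p ->
  primitive_on theta U F -> primitive_on theta U' F' ->
  primitive_on (form_mul F eta) U K -> primitive_on (form_mul F' eta) U' K' ->
  exists W : set S, [/\ open W, W p, W `<=` U `&` U' & forall q, W q ->
    F' q = F q /\ K' q - K q = K' p - K p].
Proof.
move=> oU oU' Up Up' FF pF pF' pK pK'.
have [W [oW Wp WU WE]] := primitive_unique oU oU' Up Up' pF pF'.
have FE q : W q -> F' q = F q.
  by move/WE; rewrite FF subrr => /eqP; rewrite subr_eq0 => /eqP.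
have pKW : primitive_on (form_mul F eta) W K.
  by apply: primitive_onS pK => q /WU[].
have pK'W : primitive_on (form_mul F eta) W K'.
  move=> f q Af fq Wq; have := pK' _ _ Af fq (WU _ Wq).2.
  by rewrite /form_mul FE.
have [W' [oW' Wp' WW' WE']] := primitive_unique oW oW Wp Wp pKW pK'W.
exists W'; split=> // [q /WW'[/WU//]|q Wq].
by split; [apply: FE; have [] := WW' _ Wq | exact: WE'].
Qed.

End Forms.

(** * Primitives and iterated primitives along a map from the unit square *)

Section SquarePrimitives.
Variables (R : realType) (S : riemannSurface R).
Local Notation C := (CC R).
Local Notation I := (box (0 : R) 0 1 1).
Variable gam : R -> R -> S.
Hypothesis gam_cont : forall s t, I s t -> forall U : set S, open U -> U (gam s t) ->
  near_in I s t (fun s' t' => U (gam s' t')).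

Lemma near_in_near (D : R -> R -> bool) s t (Q : R -> R -> Prop) : near_in D s t Q ->
  near_in D s t (fun s' t' => near_in D s' t' Q).
Proof.
move=> [d d0 dP]; have d20 : 0 < d / 2 by rewrite divr_gt0.
exists (d / 2) => // s' t' D' hs ht; exists (d / 2) => // s2 t2 D2 hs2 ht2.
by apply: dP => //; rewrite [d]splitr; [rewrite -(subrKA s') | rewrite -(subrKA t')];
  apply: le_lt_trans (ler_normD _ _) _; apply: ltrD.
Qed.

Lemma near_in_self (D : R -> R -> bool) s t (Q : R -> R -> Prop) : D s t -> near_in D s t Q -> Q s t.
Proof. by move=> Ds [d d0]; apply; rewrite ?subrr ?normr0. Qed.

Definition square_primitive (omega : one_form S) (f : R -> R -> C) :=
  forall s t, I s t -> exists (U : set S) F, [/\ open U, U (gam s t),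
    primitive_on omega U F & near_in I s t (fun s' t' => f s' t' = F (gam s' t'))].

(** The same [F] represents [f] and multiplies eta. Tying the two fixes the additive constant in
    [F], on which the form integrated by [K] depends. *)
Definition square_iterated (omega eta : one_form S) (f h : R -> R -> C) :=
  forall s t, I s t -> exists (U : set S) F K, [/\ open U, U (gam s t),
    primitive_on omega U F, primitive_on (form_mul F eta) U K &
    near_in I s t (fun s' t' => f s' t' = F (gam s' t') /\ h s' t' = K (gam s' t'))].

Lemma square_primitive_exists omega : holomorphic_form omega ->
  exists f, square_primitive omega f.
Proof.
move=> [ho co].
pose P s t (p : R -> R -> C) := exists (U : set S) F, [/\ open U, U (gam s t),
   primitive_on omega U F & p = fun s' t' => F (gam s' t')].
have [|||f fP] := @continuation R C P.
- move=> s t Ist.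
  have [|U [F [oU Up _ pF]]] := primitive_exists (p := gam s t) co _ openT Logic.I.
    by move=> f p Af fp _; exact: ho.
  exists (fun s' t' => F (gam s' t')).
  by apply: near_inS (gam_cont Ist oU Up) => // s' t' _ h _; exists U, F.
- move=> s t p p' Ist [U [F [oU Up pF ->]]] [U' [F' [oU' Up' pF' ->]]].
  have [W [oW Wp _ WE]] := primitive_unique oU oU' Up Up' pF pF'.
  by apply: near_inS (gam_cont Ist oW Wp) => // s' t' _ /WE.
- move=> s t p c [U [F [oU Up pF ->]]]; exists U, (fun q => F q + c); split=> //.
  exact: primitive_on_addr.
exists f => s t Ist; have [p [U [F [oU Up pF ->]]] np] := fP s t Ist.
by exists U, F.
Qed.

Lemma square_iterated_exists omega eta f : holomorphic_form eta ->
  square_primitive omega f -> exists h, square_iterated omega eta f h.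
Proof.
move=> [he ce] pf.
(* Requiring [F] to match the given [f] near (s, t) makes the germ of [K] unique up to a constant,
   as continuation demands. *)
pose P s t (p : R -> R -> C) := exists (U : set S) F K, [/\ open U, U (gam s t),
   primitive_on omega U F /\ near_in I s t (fun s' t' => f s' t' = F (gam s' t')),
   primitive_on (form_mul F eta) U K & p = fun s' t' => K (gam s' t')].
have [|||h hP] := @continuation R C P.
- move=> s t Ist; have [U [F [oU Up pF nF]]] := pf s t Ist.
  have hF : holomorphic_on (form_mul F eta) U.
    by apply: holomorphic_mul pF _ => g p Ag gp _; exact: he.
  have [U' [K [oU' Up' UU' pK]]] := primitive_exists (compatible_mul F ce) hF oU Up.
  exists (fun s' t' => K (gam s' t')).
  apply: near_inS (near_inI (gam_cont Ist oU' Up') (near_in_near nF)) => // s' t' _ [U's ns] _.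
  by exists U', F, K; split=> //; split=> //; exact: primitive_onS pF.
- move=> s t p p' Ist [U [F [K [oU Up [pF nF] pK ->]]]].
  move=> [U' [F' [K' [oU' Up' [pF' nF'] pK' ->]]]].
  have FF : F (gam s t) = F' (gam s t).
    by rewrite -(near_in_self Ist nF) -(near_in_self Ist nF').
  have [W [oW Wp _ WE]] := primitive_unique2 oU oU' Up Up' FF pF pF' pK pK'.
  by apply: near_inS (gam_cont Ist oW Wp) => // s' t' _ /WE[].
- move=> s t p c [U [F [K [oU Up pnF pK ->]]]].
  by exists U, F, (fun q => K q + c); split=> //; exact: primitive_on_addr.
exists h => s t Ist; have [p [U [F [K [oU Up [pF nF] pK ->]]]] np] := hP s t Ist.
by exists U, F, K; split=> //; exact: near_inI.
Qed.

End SquarePrimitives.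

(** * Coordinates on simplices of dimension 1 and 2 *)

Section Simplices.
Variable R : realType.

Lemma simplex_nbhsP n (t : @stdsimplex R n) (V : set (@stdsimplex R n)) :
  nbhs t V <-> exists2 e : R, 0 < e & forall u : @stdsimplex R n,
    (forall i, `|set_val u 0 i - set_val t 0 i| < e) -> V u.
Proof.
split=> [[W [[W' oW' <-] W't WV]]|[e e0 eV]].
  have /nbhs_ballP[e e0 eW] : nbhs (set_val t) W' by exact: open_nbhs_nbhs.
  exists e => // u ut; apply: WV; apply: eW; split=> // i j.
  by rewrite ord1; have := ut j; rewrite -ball_normE /= distrC.
have : nbhs t (set_val @^-1` ball (set_val t) e).
  by apply: initial_continuous; exact: nbhsx_ballx.
apply: filterS => u [_ tu]; apply: eV => i.
by have := tu 0 i; rewrite -ball_normE /= distrC.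
Qed.

Definition bary (u : @stdsimplex R 1) : R := set_val u 0 ord_max.

Lemma bary_in (u : @stdsimplex R 1) : 0 <= bary u <= 1.
Proof.
have [t0 ts] := set_valP u; rewrite /bary t0 -ts big_ord_recr /= lerDr.
by rewrite sumr_ge0.
Qed.

Lemma bary0 (u : @stdsimplex R 1) : set_val u 0 ord0 = 1 - bary u.
Proof.
have [_ <-] := set_valP u; rewrite big_ord_recr /= big_ord1 /bary addrK.
by congr (_ _ _); apply/val_inj.
Qed.

Lemma bary_inj (u v : @stdsimplex R 1) : bary u = bary v -> u = v.
Proof.
move=> uv; apply: val_inj; apply/rowP => i; case: (unliftP ord_max i) => [j|] ->; last exact: uv.
have -> : fintype.lift ord_max j = ord0 :> 'I_2 by rewrite ord1; apply/val_inj.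
by rewrite !bary0 uv.
Qed.

Lemma mk_simplex n (a : 'I_n.+1 -> R) : (forall i, 0 <= a i) -> \sum_i a i = 1 ->
  exists u : @stdsimplex R n, forall i, set_val u 0 i = a i.
Proof.
move=> a0 a1; have h : (\row_i a i) \in @stdsimplex R n.
  apply/mem_set; split=> [i|]; first by rewrite mxE.
  by rewrite -[RHS]a1; apply: eq_bigr => i _; rewrite mxE.
by exists (exist (fun t => t \in @stdsimplex R n) _ h) => i; rewrite /= mxE.
Qed.

(** The implication stands under the quantifier so that choice yields a total function on the real
    line, arbitrary outside [0, 1]. *)
Lemma seg_exists (x : R) : exists u : @stdsimplex R 1, 0 <= x <= 1 -> bary u = x.
Proof.
have [x01|] := boolP (0 <= x <= 1); last by exists (vertex R ord0).
have [||u uE] := @mk_simplex 1 (fun i => if i == ord_max then x else 1 - x).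
- by move=> i; case: ifP => _; case/andP: x01; lra.
- by rewrite big_ord_recr /= big_ord1 /= subrK.
by exists u; rewrite /bary uE eqxx.
Qed.

Lemma simplex1_nbhs (t : @stdsimplex R 1) (V : set (@stdsimplex R 1)) :
  nbhs t V <-> exists2 e : R, 0 < e & forall u, `|bary u - bary t| < e -> V u.
Proof.
rewrite simplex_nbhsP; split=> -[e e0 eV]; exists e => // u ut; last by apply: eV; exact: ut.
apply: eV => i; case: (unliftP ord_max i) => [j|] ->; last exact: ut.
have -> : fintype.lift ord_max j = ord0 :> 'I_2 by rewrite ord1; apply/val_inj.
rewrite !bary0 (_ : _ - _ = - (bary u - bary t)) ?normrN //.
by ring.
Qed.

(** [bary] identifies the 1-simplex with [0, 1], and the result for the square is applied to a
    function of the first coordinate alone. *)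
Lemma simplex1_constant (V : zmodType) (k : @stdsimplex R 1 -> V) :
  (forall t, \forall u \near t, k u = k t) -> forall t u, k t = k u.
Proof.
move=> kloc; have /choice[seg segP] := seg_exists.
have segK t : seg (bary t) = t by apply: bary_inj; rewrite segP // bary_in.
move=> t u; rewrite -(segK t) -(segK u).
pose D := box (0 : R) 0 1 1.
apply: (@locally_constant R V D (fun s _ => k (seg s)) (@box_convex _ _ _ _ _) _ (bary t) 0 (bary u) 0).
- move=> s s' /andP[]; rewrite add0r => s01 _.
  have /simplex1_nbhs[e e0 eP] := kloc (seg s); exists e => // x y.
  move=> /andP[]; rewrite add0r => x01 _ xs _; apply: eP.
  by rewrite !segP.
- by rewrite /D /box !add0r bary_in lexx ler01.
- by rewrite /D /box !add0r bary_in lexx ler01.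
Qed.

(* The edge x = 0 of the square is collapsed to the vertex v0; y = 0, y = 1 and
   x = 1 parametrize the edges [v0, v1], [v0, v2] and [v1, v2]. *)
Lemma square_to_triangle (x y : R) : exists u : @stdsimplex R 2, box 0 0 1 1 x y ->
  [/\ set_val u 0 (inord 0) = 1 - x, set_val u 0 (inord 1) = x * (1 - y) &
      set_val u 0 (inord 2) = x * y].
Proof.
have [xy|] := boolP (box 0 0 1 1 x y); last by exists (vertex R ord0).
move: xy; rewrite /box !add0r => /andP[/andP[x0 x1] /andP[y0 y1]].
have [||u uE] := @mk_simplex 2 (fun i => [:: 1 - x; x * (1 - y); x * y]`_i).
- by case=> [[|[|[|]]] ] //= _; nra.
- by rewrite !big_ord_recr big_ord0 /=; ring.
by exists u; rewrite !uE !inordK.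
Qed.

End Simplices.

(** * Iterated integrals *)

Section IteratedIntegrals.
Variables (R : realType) (S : riemannSurface R).
Local Notation C := (CC R).
Local Notation v0 := (vertex R (ord0 : 'I_2)).
Local Notation v1 := (vertex R (ord_max : 'I_2)).

Lemma bary_v0 : bary v0 = 0.
Proof. by rewrite /bary /= mxE. Qed.

Lemma bary_v1 : bary v1 = 1.
Proof. by rewrite /bary /= mxE. Qed.

Definition iterated_along (omega eta : one_form S) (sigma : simplex R S 1)
    (f h : @stdsimplex R 1 -> C) :=
  forall t, exists (U : set S) F K, [/\ open U, U (sigma t),
    primitive_on omega U F, primitive_on (form_mul F eta) U K &
    \forall u \near t, f u = F (sigma u) /\ h u = K (sigma u)].

Lemma near_path (sigma : simplex R S 1) (W : set S) t : open W -> W (sigma t) ->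
  \forall u \near t, W (sigma u).
Proof.
by move=> oW Wt; have : nbhs (sigma t) W by [exact: open_nbhs_nbhs];
  exact: (@cts_fun _ _ sigma).
Qed.

Lemma primitive_along_unique omega (sigma : simplex R S 1) g g' :
  primitive_along omega sigma g -> primitive_along omega sigma g' ->
  forall t u, g' t - g t = g' u - g u.
Proof.
move=> pg pg'; apply: (simplex1_constant (k := fun t => g' t - g t)) => t.
have [U [F [oU Ut pF nF]]] := pg t; have [U' [F' [oU' Ut' pF' nF']]] := pg' t.
have [W [oW Wt _ WE]] := primitive_unique oU oU' Ut Ut' pF pF'.
have E := WE _ Wt; near=> u.
have -> : g u = F (sigma u) by near: u.
have -> : g' u = F' (sigma u) by near: u.
rewrite (nbhs_singleton nF) (nbhs_singleton nF'); apply: WE.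
by near: u; exact: near_path.
Unshelve. all: by end_near. Qed.

(** Two primitives along [sigma] differ by a constant, so the arbitrary choice in the definition
    does not affect the difference of end values. *)
Lemma path_integralE omega (sigma : simplex R S 1) g :
  primitive_along omega sigma g -> path_integral omega sigma = g v1 - g v0.
Proof.
move=> pg; rewrite /path_integral; case: xgetP => [z _ [g' pg' ->]|/(_ (g v1 - g v0))[]].
  have := primitive_along_unique pg pg' v1 v0 => /eqP.
  by rewrite subr_eq addrAC -subr_eq0 => /eqP E; apply/eqP; rewrite -subr_eq0 -E; apply/eqP; ring.
by exists g.
Qed.

(** Equal initial values force [f] and [f'] to agree everywhere; then [h] and [h'] continue
    primitives of the same local forms. *)
Lemma iterated_unique omega eta (sigma : simplex R S 1) f h f' h' :
  f v0 = f' v0 ->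
  iterated_along omega eta sigma f h -> iterated_along omega eta sigma f' h' ->
  h' v1 - h' v0 = h v1 - h v0.
Proof.
move=> ff p p'.
have fE t : f t = f' t.
  suff : f t - f' t = f v0 - f' v0.
    by rewrite ff subrr => /eqP; rewrite subr_eq0 => /eqP.
  have pf : primitive_along omega sigma f.
    move=> u; have [U [F [K [oU Ut pF pK nF]]]] := p u; exists U, F; split=> //.
    by apply: filterS nF => w [].
  have pf' : primitive_along omega sigma f'.
    move=> u; have [U [F [K [oU Ut pF pK nF]]]] := p' u; exists U, F; split=> //.
    by apply: filterS nF => w [].
  exact: primitive_along_unique pf' pf _ _.
suff : h' v1 - h v1 = h' v0 - h v0.
  by move=> /eqP; rewrite subr_eq => /eqP ->; ring.
apply: (simplex1_constant (k := fun t => h' t - h t)) => t.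
have [U [F [K [oU Ut pF pK nF]]]] := p t.
have [U' [F' [K' [oU' Ut' pF' pK' nF']]]] := p' t.
have [f0 h0] := nbhs_singleton nF; have [f0' h0'] := nbhs_singleton nF'.
have FF : F (sigma t) = F' (sigma t) by rewrite -f0 -f0'.
have [W [oW Wt _ WE]] := primitive_unique2 oU oU' Ut Ut' FF pF pF' pK pK'.
near=> u.
have [_ ->] : f u = F (sigma u) /\ h u = K (sigma u) by near: u.
have [_ ->] : f' u = F' (sigma u) /\ h' u = K' (sigma u) by near: u.
rewrite h0 h0'; suff /WE[] : W (sigma u) by [].
by near: u; exact: near_path.
Unshelve. all: by end_near. Qed.

(* Normalizing f to vanish at the initial vertex makes h unique up to a constant. *)
Definition iterated_integral (omega eta : one_form S) (sigma : simplex R S 1) : C :=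
  xget 0 [set z | exists f h, [/\ iterated_along omega eta sigma f h, f v0 = 0 &
                                 z = h v1 - h v0]].

(** Normalizing [f] by its initial value c replaces F eta by (F - c) eta, whose primitive is K - c
    G. This is the origin of the correction term. *)
Lemma iterated_integralE omega eta (sigma : simplex R S 1) f g h :
  primitive_along eta sigma g -> iterated_along omega eta sigma f h ->
  iterated_integral omega eta sigma = h v1 - h v0 - f v0 * (g v1 - g v0).
Proof.
move=> pg p; set c := f v0.
pose f' u := f u - c; pose h' u := h u - c * g u.
have p' : iterated_along omega eta sigma f' h'.
  move=> t; have [U [F [K [oU Ut pF pK nF]]]] := p t.
  have [U' [G [oU' Ut' pG nG]]] := pg t.
  exists (U `&` U'), (fun q => F q - c), (fun q => K q - c * G q); split.
  - exact: openI.
  - by split.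
  - by apply: primitive_on_addr; apply: primitive_onS pF => q [].
  - move=> x q Ax xq [Uq Uq']; have /has_derivP hK := pK _ _ Ax xq Uq.
    have /has_derivP hG := pG _ _ Ax xq Uq'; apply/has_derivP.
    have := has_derivB hK (has_derivM (has_deriv_cst c (x q)) hG).
    by rewrite mulr0 addr0 /form_mul mulrBl.
  - by apply: filterS2 nF nG => u [fu hu] gu; rewrite /f' /h' fu hu gu.
have f'0 : f' v0 = 0 by rewrite /f' subrr.
rewrite /iterated_integral; case: xgetP => [z _ [f2 [h2 [p2 f20 ->]]]|].
  by rewrite (iterated_unique _ p' p2) ?f'0 ?f20 // /h'; ring.
by move=> /(_ (h' v1 - h' v0))[]; exists f', h'.
Qed.

Local Notation I := (box (0 : R) 0 1 1).

(** * Restriction from the square to one of its edges *)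

Section Pullback.
Variables (gam : R -> R -> S) (a b : R -> R) (sigma : simplex R S 1).
Hypothesis ab_in : forall x, 0 <= x <= 1 -> I (a x) (b x).
Hypothesis a_lip : forall x y, `|a x - a y| <= `|x - y|.
Hypothesis b_lip : forall x y, `|b x - b y| <= `|x - y|.
Hypothesis sigmaE : forall u, sigma u = gam (a (bary u)) (b (bary u)).

(** Both coordinates of the edge are 1-Lipschitz in [bary], so the radius in the square also works
    on the edge. *)
Lemma near_pullback t (Q : R -> R -> Prop) :
  near_in I (a (bary t)) (b (bary t)) Q ->
  \forall u \near t, Q (a (bary u)) (b (bary u)).
Proof.
move=> [d d0 dP]; apply/simplex1_nbhs; exists d => // u ut.
by apply: dP; [exact/ab_in/bary_in | exact: le_lt_trans ut | exact: le_lt_trans ut].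
Qed.

Lemma primitive_pullback omega f : square_primitive gam omega f ->
  primitive_along omega sigma (fun u => f (a (bary u)) (b (bary u))).
Proof.
move=> pf t; have [U [F [oU Ut pF nF]]] := pf _ _ (ab_in (bary_in t)).
exists U, F; split=> //; first by rewrite sigmaE.
by have := near_pullback nF; apply: filterS => u; rewrite sigmaE.
Qed.

Lemma iterated_pullback omega eta f h : square_iterated gam omega eta f h ->
  iterated_along omega eta sigma (fun u => f (a (bary u)) (b (bary u)))
    (fun u => h (a (bary u)) (b (bary u))).
Proof.
move=> pf t; have [U [F [K [oU Ut pF pK nF]]]] := pf _ _ (ab_in (bary_in t)).
exists U, F, K; split=> //; first by rewrite sigmaE.
by have := near_pullback nF; apply: filterS => u; rewrite sigmaE.
Qed.

End Pullback.

(** * Stokes' formula on a singular triangle *)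

Section Triangle.
Variables (omega eta : one_form S) (tau : simplex R S 2).
Hypotheses (holo_omega : holomorphic_form omega) (holo_eta : holomorphic_form eta).

Local Notation mid := (inord 1 : 'I_3).

Lemma ord3P (i : 'I_3) : [\/ i = inord 0, i = inord 1 | i = inord 2].
Proof.
case: i => [[|[|[|]]]] //= h; [constructor 1|constructor 2|constructor 3];
  by apply/val_inj; rewrite /= inordK.
Qed.

Lemma triangle_parametrization : exists gam : R -> R -> S, [/\
  forall s t, I s t -> forall U : set S, open U -> U (gam s t) ->
    near_in I s t (fun s' t' => U (gam s' t')),
  forall u, face ord_max tau u = gam (bary u) 0,
  forall u, face mid tau u = gam (bary u) 1,
  forall u, face ord0 tau u = gam 1 (bary u) &
  forall t, 0 <= t <= 1 -> gam 0 t = gam 0 0].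
Proof.
have /choice[tri' triP'] := fun xy : R * R => square_to_triangle xy.1 xy.2.
pose tri x y := tri' (x, y).
have triP x y : box 0 0 1 1 x y ->
    [/\ set_val (tri x y) 0 (inord 0) = 1 - x, set_val (tri x y) 0 (inord 1) = x * (1 - y) &
      set_val (tri x y) 0 (inord 2) = x * y] by exact: triP' (x, y).
have triE (u : @stdsimplex R 2) x y : box 0 0 1 1 x y ->
    set_val u 0 (inord 0) = 1 - x -> set_val u 0 (inord 1) = x * (1 - y) ->
    set_val u 0 (inord 2) = x * y -> u = tri x y.
  move=> /triP[e0 e1 e2] u0 u1 u2; apply: val_inj; apply/rowP => i.
  by have [->|->|->] := ord3P i; rewrite ?u0 ?u1 ?u2.
have i0 : (ord0 : 'I_3) = inord 0 by apply/val_inj; rewrite /= inordK.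
have i2 : (ord_max : 'I_3) = inord 2 by apply/val_inj; rewrite /= inordK.
have ins (i : 'I_3) (k : 'I_2) (u : @stdsimplex R 1) (j : 'I_3) :
    j = fintype.lift i k -> set_val (coface i u) 0 j = set_val u 0 k.
  by move=> ->; rewrite /= mxE liftK.
have ins0 (i : 'I_3) (u : @stdsimplex R 1) : set_val (coface i u) 0 i = 0.
  by rewrite /= mxE unlift_none.
have bI u : I (bary u) 0 /\ I (bary u) 1 /\ I 1 (bary u).
  by rewrite /box !add0r !bary_in !lexx !ler01.
exists (fun x y => tau (tri x y)); split.
- move=> s t Ist U oU Ut.
  have /simplex_nbhsP[e e0 eP] : nbhs (tri s t) (tau @^-1` U).
    by apply: (@cts_fun _ _ tau); exact: open_nbhs_nbhs.
  exists (e / 2) => [|x y Ixy]; first by rewrite divr_gt0.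
  rewrite !ltr_norml => /andP[x1 x2] /andP[y1 y2]; apply: eP => i.
  have [a0 a1 a2] := triP _ _ Ixy; have [b0 b1 b2] := triP _ _ Ist.
  move: Ixy Ist; rewrite /box !add0r => /andP[/andP[? ?] /andP[? ?]] /andP[/andP[? ?] /andP[? ?]].
  rewrite ltr_norml; have [->|->|->] := ord3P i.
  + by rewrite a0 b0; apply/andP; split; lra.
  + rewrite a1 b1.
    (* Each of the two terms is smaller than e/2 in absolute value, since the cofactors lie in
       [0, 1]. *)
    have -> : x * (1 - y) - s * (1 - t) = (x - s) * (1 - y) - s * (y - t) by ring.
    by apply/andP; split; nra.
  + rewrite a2 b2.
    have -> : x * y - s * t = (x - s) * y + s * (y - t) by ring.
    by apply/andP; split; nra.
- move=> u; rewrite /face /=; congr (tau _); apply: triE; first by have [] := bI u.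
  + by rewrite (ins _ ord0) ?bary0 //; apply/val_inj; rewrite /= inordK.
  + rewrite (ins _ ord_max) ?subr0 ?mulr1 //; first by apply/val_inj; rewrite /= inordK.
  + by rewrite -i2 ins0 mulr0.
- move=> u; rewrite /face /=; congr (tau _); apply: triE; first by have [_ []] := bI u.
  + by rewrite (ins _ ord0) ?bary0 //; apply/val_inj; rewrite /= !inordK.
  + by rewrite ins0 subrr mulr0.
  + rewrite (ins _ ord_max) ?mulr1 //; by apply/val_inj; rewrite /= !inordK.
- move=> u; rewrite /face /=; congr (tau _); apply: triE; first by have [_ []] := bI u.
  + by rewrite -i0 ins0 subrr.
  + by rewrite (ins _ ord0) ?bary0 ?mul1r //; apply/val_inj; rewrite /= !inordK.
  + rewrite (ins _ ord_max) ?mul1r //; by apply/val_inj; rewrite /= !inordK.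
- move=> t t01; congr (tau _); apply: triE.
  + by rewrite /box !add0r lexx ler01.
  + by have [|-> _ _] := triP 0 t; rewrite ?subr0 // /box !add0r lexx ler01.
  + by have [|_ -> _] := triP 0 t; rewrite ?mul0r // /box !add0r lexx ler01.
  + by have [|_ _ ->] := triP 0 t; rewrite ?mul0r // /box !add0r lexx ler01.
Qed.

(** One triple [f], [g], [h] on the square computes all three edges through its values at the
    corners. The collapsed edge identifies the values at (0, 0) and (0, 1), and both identities
    become algebra. *)
Lemma triangle_stokes :
  path_integral omega (face ord0 tau) - path_integral omega (face mid tau)
    + path_integral omega (face ord_max tau) = 0 /\
  path_integral omega (face ord_max tau) * path_integral eta (face ord0 tau) =
    iterated_integral omega eta (face mid tau)
    - iterated_integral omega eta (face ord_max tau)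
    - iterated_integral omega eta (face ord0 tau).
Proof.
have [gam [gc g2 g1 g0 gL]] := triangle_parametrization.
have [f pf] := square_primitive_exists gc holo_omega.
have [g pg] := square_primitive_exists gc holo_eta.
have [h ph] := square_iterated_exists gc holo_eta pf.
have in2 (x : R) : 0 <= x <= 1 -> I x 0 by rewrite /box !add0r lexx ler01 => ->.
have in1 (x : R) : 0 <= x <= 1 -> I x 1 by rewrite /box !add0r lexx ler01 => ->.
have in0 (x : R) : 0 <= x <= 1 -> I 1 x by rewrite /box !add0r lexx ler01.
have lc (c x y : R) : `|c - c| <= `|x - y| by rewrite subrr normr0.
have li (x y : R) : `|x - y| <= `|x - y| by [].
(* The map [gam] is constant on the collapsed edge, so a function factoring locally through it is
   locally constant there. The edge is a box of width 0. *)
have left_edge (k : R -> R -> C) :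
    (forall t, 0 <= t <= 1 -> exists (U : set S) (K : S -> C), [/\ open U, U (gam 0 t) &
       near_in I 0 t (fun s' t' => k s' t' = K (gam s' t'))]) -> k 0 1 = k 0 0.
  move=> kP; pose D := box (0 : R) 0 0 1.
  have DI x y : D x y -> x = 0 /\ 0 <= y <= 1.
    by rewrite /D /box !add0r => /andP[/le_anti <- ->].
  apply: (@locally_constant R C D k (@box_convex _ _ _ _ _)).
  - move=> s t /DI[-> t01]; have [U [K [oU Ut nK]]] := kP t t01.
    have [d d0 dP] := nK; exists d => // x y /DI[-> y01] xd yd.
    have It z : 0 <= z <= 1 -> I 0 z by rewrite /box !add0r lexx ler01.
    rewrite (dP 0 y) //; last exact: It.
    rewrite (dP 0 t) ?subrr ?normr0 //; last exact: It.
    by rewrite gL // (gL t).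
  - by rewrite /D /box !add0r !lexx ler01.
  - by rewrite /D /box !add0r !lexx ler01.
have It z : 0 <= z <= 1 -> I 0 z by rewrite /box !add0r lexx ler01.
have fL : f 0 1 = f 0 0.
  by apply: left_edge => t /It/pf[U [F [oU Ut _ nF]]]; exists U, F.
have gLL : g 0 1 = g 0 0.
  by apply: left_edge => t /It/pg[U [F [oU Ut _ nF]]]; exists U, F.
have hL : h 0 1 = h 0 0.
  apply: left_edge => t /It/ph[U [F [K [oU Ut _ _ nF]]]]; exists U, K; split=> //.
  by apply: near_inS nF => // ? ? _ [].
have P2 th k (pk : square_primitive gam th k) :=
  path_integralE (primitive_pullback in2 li (lc 0) g2 pk).
have P1 th k (pk : square_primitive gam th k) :=
  path_integralE (primitive_pullback in1 li (lc 1) g1 pk).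
have P0 th k (pk : square_primitive gam th k) :=
  path_integralE (primitive_pullback in0 (lc 1) li g0 pk).
have J2 := iterated_integralE (primitive_pullback in2 li (lc 0) g2 pg)
  (iterated_pullback in2 li (lc 0) g2 ph).
have J1 := iterated_integralE (primitive_pullback in1 li (lc 1) g1 pg)
  (iterated_pullback in1 li (lc 1) g1 ph).
have J0 := iterated_integralE (primitive_pullback in0 (lc 1) li g0 pg)
  (iterated_pullback in0 (lc 1) li g0 ph).
rewrite (P0 _ _ pf) (P1 _ _ pf) (P2 _ _ pf) (P0 _ _ pg) J0 J1 J2.
by rewrite !bary_v0 !bary_v1 fL gLL hL; split; ring.
Qed.

End Triangle.
End IteratedIntegrals.

(** * Cup products and periods *)

Section Extend.
Variables (R : realType) (S : topologicalType).

Lemma extendB n (V : zmodType) (f : simplex R S n -> V) : {morph extend f : c d / c - d}.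
Proof. by move=> c d; exact: (@lift_is_additive _ _ (zmodule V) f). Qed.

HB.instance Definition _ n (V : zmodType) (f : simplex R S n -> V) :=
  GRing.isAdditive.Build (chain R S n) V (extend f) (extendB f).

Lemma extendU n (V : zmodType) (f : simplex R S n -> V) k sigma :
  extend f << k *g sigma >> = f sigma *~ k.
Proof. by rewrite /extend (@liftU _ (zmodule V)). Qed.

Lemma extendU1 n (V : zmodType) (f : simplex R S n -> V) sigma :
  extend f << sigma >> = f sigma.
Proof. by rewrite extendU mulr1z. Qed.

Lemma extendE n (V : zmodType) (f : simplex R S n -> V) c :
  extend f c = \sum_(x <- dom c) f x *~ coeff x c.
Proof.
rewrite -[in LHS](freeg_sumE c) raddf_sum.
by apply: eq_bigr => x _; exact: extendU.
Qed.

Lemma eq_extend n (V : zmodType) (f g : simplex R S n -> V) c :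
  f =1 g -> extend f c = extend g c.
Proof. by move=> fg; congr extend; apply/funext. Qed.

Lemma raddf_extend n (V W : zmodType) (g : {additive V -> W}) (f : simplex R S n -> V) c :
  g (extend f c) = extend (fun x => g (f x)) c.
Proof. by rewrite !extendE raddf_sum; apply: eq_bigr => x _; rewrite raddfMz. Qed.

Lemma extend_add n (V : zmodType) (f g : simplex R S n -> V) c :
  extend (fun x => f x + g x) c = extend f c + extend g c.
Proof. by rewrite !extendE -big_split; apply: eq_bigr => x _; rewrite mulrzDl. Qed.

Lemma extend_opp n (V : zmodType) (f : simplex R S n -> V) c :
  extend (fun x => - f x) c = - extend f c.
Proof. by rewrite !extendE -sumrN; apply: eq_bigr => x _; rewrite mulNrz. Qed.

Lemma extend_sum n (V : zmodType) (J : finType) (f : J -> simplex R S n -> V) c :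
  extend (fun x => \sum_j f j x) c = \sum_j extend (f j) c.
Proof.
rewrite extendE; under [RHS]eq_bigr do rewrite extendE.
rewrite exchange_big; apply: eq_bigr => x _.
by rewrite mulrz_suml.
Qed.

Lemma extend_mull n (K : pzRingType) (a : K) (f : simplex R S n -> K) c :
  extend (fun x => a * f x) c = a * extend f c.
Proof. by rewrite !extendE mulr_sumr; apply: eq_bigr => x _; rewrite mulrzAr. Qed.

Lemma extend_boundary n (V : zmodType) (f : simplex R S n -> V) c :
  extend f (boundary c) =
  extend (fun sigma => \sum_(i < n.+2) f (face i sigma) *~ (-1) ^+ i) c.
Proof.
rewrite (raddf_extend (extend f)); apply: eq_extend => sigma.
by rewrite raddf_sum; apply: eq_bigr => i _; exact: extendU.
Qed.

Lemma boundaryB n : {morph @boundary R S n : c d / c - d}.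
Proof. exact: extendB. Qed.

HB.instance Definition _ n :=
  GRing.isAdditive.Build (chain R S n.+1) (chain R S n) (@boundary R S n) (@boundaryB n).

End Extend.

(** * Closed cochains, cup products and intersection numbers *)

Section CupProduct.
Variables (R : realType) (S : topologicalType).

Local Notation mid := (inord 1 : 'I_3).

(** The cocycle condition on a single simplex, with arbitrary coefficients: it applies both to
    integral cocycles and to complex periods. *)
Definition closed_cochain (V : zmodType) (f : simplex R S 1 -> V) :=
  forall tau : simplex R S 2, f (face mid tau) = f (face ord_max tau) + f (face ord0 tau).

Lemma sum_face (V : zmodType) (f : simplex R S 1 -> V) tau :
  \sum_(i < 3) f (face i tau) *~ (-1) ^+ i =
  f (face ord0 tau) - f (face mid tau) + f (face ord_max tau).
Proof.
rewrite !big_ord_recl big_ord0 /= /bump /= expr0 expr1 sqrrN expr1n !mulr1z addr0.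
rewrite mulrNz mulr1z addrA; congr (_ - f (face _ _) + f (face _ _)); apply/val_inj => //=.
by rewrite inordK.
Qed.

Lemma cocycle_closed (phi : simplex R S 1 -> int) : cocycle phi -> closed_cochain phi.
Proof.
move=> cphi tau; have := cphi << tau >>.
rewrite extend_boundary extendU1 sum_face => /eqP.
by rewrite addrAC subr_eq0 addrC => /eqP.
Qed.

Lemma closed_boundary (V : zmodType) (f : simplex R S 1 -> V) (c : chain R S 2) :
  closed_cochain f -> extend f (boundary c) = 0.
Proof.
move=> cf; rewrite extend_boundary extendE big1 // => tau _.
by rewrite sum_face cf opprD addrCA subrr addr0 addNr mul0rz.
Qed.

Lemma closed_homologous (V : zmodType) (f : simplex R S 1 -> V) a b :
  closed_cochain f -> homologous a b -> extend f a = extend f b.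
Proof.
by move=> cf [c ab]; apply/eqP; rewrite -subr_eq0 -extendB ab closed_boundary.
Qed.

Lemma coface_lift n (i : 'I_n.+2) (u : @stdsimplex R n) j k :
  j = fintype.lift i k -> set_val (coface i u) 0 j = set_val u 0 k.
Proof. by move=> ->; rewrite /= mxE liftK. Qed.

Lemma coface_diag n (i : 'I_n.+2) (u : @stdsimplex R n) j :
  j = i -> set_val (coface i u) 0 j = 0.
Proof. by move=> ->; rewrite /= mxE unlift_none. Qed.

(** Both sides are the vertex v0, reached through the edges [v0, v2] and [v0, v1]. *)
Lemma initial_vertex_face (tau : simplex R S 2) :
  face ord_max (face mid tau) = face ord_max (face ord_max tau).
Proof.
apply/continuousEP => t; congr (tau _); apply: val_inj; apply/rowP => i.
have [->|->|->] := ord3P i.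
- by rewrite !(@coface_lift _ _ _ _ ord0) //; apply/val_inj; rewrite /= ?inordK.
- rewrite coface_diag // (@coface_lift _ _ _ _ ord_max) ?coface_diag //.
  by apply/val_inj; rewrite /= ?inordK.
- rewrite (@coface_lift _ _ _ _ ord_max); last by apply/val_inj; rewrite /= ?inordK.
  by rewrite !coface_diag //; apply/val_inj; rewrite /= ?inordK.
Qed.

(** Both sides are the vertex v1, shared by [v1, v2] and [v0, v1]. *)
Lemma middle_vertex_face (tau : simplex R S 2) :
  face ord_max (face ord0 tau) = face ord0 (face ord_max tau).
Proof.
apply/continuousEP => t; congr (tau _); apply: val_inj; apply/rowP => i.
have [->|->|->] := ord3P i.
- rewrite coface_diag; last by apply/val_inj; rewrite /= ?inordK.
  rewrite (@coface_lift _ _ _ _ ord0); last by apply/val_inj; rewrite /= ?inordK.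
  by rewrite coface_diag.
- rewrite (@coface_lift _ _ _ _ ord0); last by apply/val_inj; rewrite /= ?inordK.
  rewrite (@coface_lift _ _ _ _ ord0); last by apply/val_inj.
  rewrite (@coface_lift _ _ _ _ ord_max); last by apply/val_inj; rewrite /= ?inordK.
  by rewrite (@coface_lift _ _ _ _ ord0) //; apply/val_inj.
- rewrite (@coface_lift _ _ _ _ ord_max); last by apply/val_inj; rewrite /= ?inordK.
  by rewrite !coface_diag //; apply/val_inj; rewrite /= ?inordK.
Qed.

Section Ring.
Variable K : comNzRingType.
Implicit Types (f g : simplex R S 1 -> K).

Definition cup_product f g (tau : simplex R S 2) : K :=
  f (face ord_max tau) * g (face ord0 tau).

Definition intr_cochain (phi : simplex R S 1 -> int) (sigma : simplex R S 1) : K :=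
  (phi sigma)%:~R.

Lemma extend_intr n (phi : simplex R S n -> int) c :
  extend (fun x => (phi x)%:~R : K) c = (extend phi c)%:~R.
Proof. by rewrite (raddf_extend (intmul (1 : K))). Qed.

Lemma closed_intr phi : closed_cochain phi -> closed_cochain (intr_cochain phi).
Proof. by move=> cphi tau; rewrite /intr_cochain cphi rmorphD. Qed.

Lemma extend_cap s phi g :
  extend g (cap s phi) = extend (cup_product (intr_cochain phi) g) s.
Proof.
rewrite (raddf_extend (extend g)); apply: eq_extend => tau.
by rewrite [LHS]extendU /cup_product /intr_cochain mulrzl.
Qed.

(** Cap and cup products are adjoint, and a closed cochain takes equal values on the homologous
    chains [cap s phi] and [a]. *)
Lemma extend_dual s phi a g : closed_cochain g -> poincare_dual s phi a ->
  extend (cup_product (intr_cochain phi) g) s = extend g a.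
Proof. by move=> cg [_ h]; rewrite -extend_cap; exact: closed_homologous. Qed.

(* On closed 1-cochains the anticommutator of the cup product is minus the
   coboundary of the pointwise product. *)
Lemma cup_productC s f g : is_cycle s -> closed_cochain f -> closed_cochain g ->
  extend (cup_product f g) s = - extend (cup_product g f) s.
Proof.
move=> cs cf cg; apply/eqP; rewrite -addr_eq0 -extend_add.
have := congr1 (extend (fun x => f x * g x)) cs.
rewrite raddf0 extend_boundary => /eqP; rewrite -oppr_eq0 -extend_opp.
congr (_ == _); apply: eq_extend => tau.
by rewrite (sum_face (fun x => f x * g x)) cf cg /cup_product; ring.
Qed.

(** For closed [g], the cup product of the coboundary of [p] with [g] is the coboundary of the
    cochain multiplying [g] by the value of [p] at the initial vertex. *)
Lemma cup_product_exact s (p : simplex R S 0 -> K) f g :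
  is_cycle s -> closed_cochain g ->
  (forall sigma, f sigma = p (face ord0 sigma) - p (face ord_max sigma)) ->
  extend (cup_product f g) s = 0.
Proof.
move=> cs cg fE.
have := congr1 (extend (fun sigma => p (face ord_max sigma) * g sigma)) cs.
rewrite raddf0 extend_boundary => h; rewrite -[RHS]h.
apply: eq_extend => tau; rewrite (sum_face (fun sigma => p (face ord_max sigma) * g sigma)) cg /cup_product fE.
by rewrite initial_vertex_face middle_vertex_face; ring.
Qed.

End Ring.

(** The relation supplies only some pair of duals. Evaluating mixed cup products by duality and
    anticommutativity transfers the number to any prescribed duals. *)
Lemma intersection_numberE s (a b : chain R S 1) k phia phib : is_cycle s ->
  intersection_number s a b k -> poincare_dual s phia a -> poincare_dual s phib b ->
  extend phib a = k /\ extend phia b = - k.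
Proof.
have intE (phi : simplex R S 1 -> int) : intr_cochain int phi = phi.
  by apply/funext => sigma; exact: intz.
have dual phi c psi : poincare_dual s phi c -> cocycle psi ->
    extend (cup_product phi psi) s = extend psi c.
  by move=> dphi /cocycle_closed cpsi; rewrite -[in LHS](intE phi); exact: extend_dual.
move=> cs [phi [psi [dphi dpsi kE]]] da db.
have comm (f g : simplex R S 1 -> int) : cocycle f -> cocycle g ->
    extend (cup_product f g) s = - extend (cup_product g f) s.
  by move=> /cocycle_closed cf /cocycle_closed cg; exact: cup_productC.
have k1 : k = extend psi a by rewrite kE -(dual phi) //; exact: dpsi.1.
have [[cpsi _] [cphia _] [cphib _]] := And3 dpsi da db.
have swap : extend psi a = - extend phia b.
  by rewrite -(dual _ _ _ da cpsi) (comm _ _ cphia cpsi) (dual _ _ _ dpsi cphia).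
split; last by rewrite k1 swap opprK.
by rewrite k1 swap -(dual _ _ _ da cphib) (comm _ _ cphia cphib) (dual _ _ _ db cphia).
Qed.

Section Periods.
Variable V : zmodType.

Lemma boundaryU (sigma : simplex R S 1) :
  boundary << sigma >> = << face ord0 sigma >> - << face ord_max sigma >> :> chain R S 0.
Proof.
rewrite /boundary extendU1 !big_ord_recl big_ord0 /= addr0 /bump /= expr0 expr1.
rewrite -freegUN; congr (_ - << face _ _ >>); exact/val_inj.
Qed.

(* A potential of J is obtained by integrating J along some integral 1-chain
   joining a chosen representative to the given vertex. *)
Lemma exact_of_vanishing (J : simplex R S 1 -> V) :
  (forall c : chain R S 1, is_cycle c -> extend J c = 0) ->
  exists p : simplex R S 0 -> V,
    forall sigma, J sigma = p (face ord0 sigma) - p (face ord_max sigma).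
Proof.
move=> J0.
have [[x0 _]|no] := pselect (exists x : simplex R S 0, True); last first.
  by exists (fun=> 0) => sigma; case: no; exists (face ord0 sigma).
pose rel (x y : simplex R S 0) := exists c : chain R S 1, boundary c = << x >> - << y >>.
have relxx x : rel x x by exists 0; rewrite raddf0 subrr.
have relC x y : rel x y -> rel y x by move=> [c cE]; exists (- c); rewrite raddfN /= cE opprB.
have relT x y z : rel x y -> rel y z -> rel x z.
  by move=> [c cE] [d dE]; exists (c + d); rewrite raddfD /= cE dE addrA subrK.
pose rep x := xget x0 [set y | rel x y].
have repP x : rel x (rep x) by rewrite /rep; case: xgetP => [y _ //|/(_ x)[]].
have repE x y : rel x y -> rep x = rep y.
  move=> xy; congr xget; apply/seteqP; split=> z /= xz; last exact: relT xz.
  by apply: relT xz; exact: relC.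
have /choice[c cP] := repP.
exists (fun x => extend J (c x)) => sigma.
set y := face ord0 sigma; set x := face ord_max sigma.
have xy : rel y x by exists << sigma >>; exact: boundaryU.
have cyc : is_cycle (<< sigma >> - (c y - c x)).
  rewrite /is_cycle boundaryB (boundaryB (c y)) boundaryU !cP (repE _ _ xy).
  by rewrite (opprB << x >>) subrKA subrr.
have := J0 _ cyc; rewrite !extendB extendU1 => /eqP; rewrite subr_eq0 => /eqP //.
Qed.

End Periods.

(** Subtracting from [f] the combination of dual cocycles with the same periods leaves an exact
    cochain, whose cup product with [g] vanishes on [s]. The remaining terms are evaluated by
    duality. *)
Lemma bilinear_periods (K : comNzRingType) h (s : chain R S 2)
    (alpha beta : 'I_h -> chain R S 1) (f g : simplex R S 1 -> K) :
  is_cycle s -> symplectic_basis s alpha beta ->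
  closed_cochain f -> closed_cochain g ->
  extend (cup_product f g) s = \sum_l (extend f (alpha l) * extend g (beta l)
                                    - extend f (beta l) * extend g (alpha l)).
Proof.
move=> cs [[ca cb basis] int_ab] cf cg.
have /choice[phi phiP] l : exists phi, poincare_dual s phi (alpha l).
  by have [[phi [psi [? _ _]]] _ _] := int_ab l l; exists phi.
have /choice[psi psiP] l : exists psi, poincare_dual s psi (beta l).
  by have [[phi' [psi [_ ? _]]] _ _] := int_ab l l; exists psi.
have psi_a j l : extend (psi l) (alpha j) = (j == l)%:R.
  by have [ab _ _] := int_ab j l; have [] := intersection_numberE cs ab (phiP j) (psiP l).
have phi_b j l : extend (phi l) (beta j) = - (j == l)%:R.
  have [ab _ _] := int_ab l j; have [] := intersection_numberE cs ab (phiP l) (psiP j).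
  by rewrite eq_sym.
have phi_a j l : extend (phi l) (alpha j) = 0.
  by have [_ aa _] := int_ab j l; have [] := intersection_numberE cs aa (phiP j) (phiP l).
have psi_b j l : extend (psi l) (beta j) = 0.
  by have [_ _ bb] := int_ab j l; have [] := intersection_numberE cs bb (psiP j) (psiP l).
(* [psi l] is 1 on [alpha l] and [phi l] is -1 on [beta l]; they vanish on the other basis cycles.
   The signs therefore make the sum of these match [f] on the basis. *)
pose dual l sigma : K := extend f (alpha l) * intr_cochain K (psi l) sigma
  - extend f (beta l) * intr_cochain K (phi l) sigma.
have cphi l : closed_cochain (intr_cochain K (phi l)).
  by apply: closed_intr; apply: cocycle_closed; case: (phiP l).
have cpsi l : closed_cochain (intr_cochain K (psi l)).
  by apply: closed_intr; apply: cocycle_closed; case: (psiP l).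
pose J sigma := f sigma - \sum_l dual l sigma.
have cJ : closed_cochain J.
  move=> tau; rewrite /J cf; rewrite (eq_bigr (fun l => dual l (face ord_max tau) + dual l (face ord0 tau))).
    by rewrite big_split /=; ring.
  by move=> l _; rewrite /dual cphi cpsi; ring.
have extJ n (F G : simplex R S n -> K) c : extend (fun x => F x - G x) c = extend F c - extend G c.
  by rewrite extend_add extend_opp.
have Jval c : extend J c = extend f c - \sum_l (extend f (alpha l) * (extend (psi l) c)%:~R
    - extend f (beta l) * (extend (phi l) c)%:~R).
  rewrite /J extJ extend_sum; congr (_ - _); apply: eq_bigr => l _.
  by rewrite /dual extJ !extend_mull !extend_intr.
have Ja j : extend J (alpha j) = 0.
  rewrite Jval (bigD1 j) //= big1 => [|l lj].
    by rewrite psi_a phi_a eqxx mulr0 mulr1 subr0 addr0 subrr.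
  by rewrite psi_a phi_a eq_sym (negPf lj) !mulr0 subr0.
have Jb j : extend J (beta j) = 0.
  rewrite Jval (bigD1 j) //= big1 => [|l lj].
    by rewrite psi_b phi_b eqxx mulr0 rmorphN mulrN mulr1 sub0r opprK addr0 subrr.
  by rewrite psi_b phi_b eq_sym (negPf lj) oppr0 !mulr0 subr0.
(* Every cycle is homologous to an integral combination of the basis, so [J] vanishes on all
   cycles. *)
have [|p pE] := @exact_of_vanishing K J.
  move=> c /basis[[x y] [hc _]]; rewrite (closed_homologous cJ hc) raddf_sum big1 // => j _.
  by rewrite raddfD !raddfMz /= Ja Jb !mul0rz addr0.
have := cup_product_exact cs cg pE.
rewrite (_ : extend _ s = extend (cup_product f g) s - \sum_l
   (extend f (alpha l) * extend (cup_product (intr_cochain K (psi l)) g) s -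
    extend f (beta l) * extend (cup_product (intr_cochain K (phi l)) g) s)).
  move=> /eqP; rewrite subr_eq0 => /eqP ->; apply: eq_bigr => l _.
  by rewrite (extend_dual cg (psiP l)) (extend_dual cg (phiP l)).
have JE : cup_product J g =1 fun tau => cup_product f g tau - \sum_l
   (extend f (alpha l) * cup_product (intr_cochain K (psi l)) g tau -
    extend f (beta l) * cup_product (intr_cochain K (phi l)) g tau).
  move=> tau; rewrite /cup_product /J mulrBl mulr_suml; congr (_ - _).
  by apply: eq_bigr => l _; rewrite /dual; ring.
rewrite (eq_extend _ JE) extJ extend_sum; congr (_ - _); apply: eq_bigr => l _.
by rewrite extJ !extend_mull.
Qed.

End CupProduct.

(** * The Riemann bilinear relation *)

Section RiemannBilinear.
Variables (R : realType) (S : riemannSurface R).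
Local Notation C := (CC R).

Lemma path_integral_closed (omega : one_form S) :
  holomorphic_form omega -> closed_cochain (path_integral omega).
Proof.
move=> ho tau; have [/eqP + _] := triangle_stokes tau ho ho.
by rewrite addrAC subr_eq0 addrC => /eqP.
Qed.

Lemma cup_path_integral (s : chain R S 2) (omega eta : one_form S) :
  is_cycle s -> holomorphic_form omega -> holomorphic_form eta ->
  extend (cup_product (path_integral omega) (path_integral eta)) s = 0.
Proof.
move=> cs ho he; have := congr1 (extend (iterated_integral omega eta)) cs.
rewrite raddf0 extend_boundary => /eqP; rewrite -oppr_eq0 -extend_opp => /eqP h.
rewrite -[RHS]h; apply: eq_extend => tau; rewrite sum_face.
by rewrite /cup_product (triangle_stokes tau ho he).2; ring.
Qed.

(** With normalized alpha-periods only the terms l = j and l = k survive, leaving the beta_j-period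
    of omega_k minus the beta_k-period of omega_j. *)
Lemma period_matrix_sym h (s : chain R S 2) (alpha beta : 'I_h -> chain R S 1)
    (omega : 'I_h -> one_form S) :
  is_cycle s -> symplectic_basis s alpha beta ->
  (forall k, holomorphic_form (omega k)) ->
  (forall j k, period (omega k) (alpha j) = (j == k)%:R) ->
  (period_matrix omega beta)^T = period_matrix omega beta.
Proof.
move=> cs sb ho pa; apply/matrixP => j k; rewrite !mxE.
have := cup_path_integral cs (ho j) (ho k).
rewrite (bilinear_periods cs sb (path_integral_closed (ho j)) (path_integral_closed (ho k))).
rewrite sumrB (bigD1 j) //= [X in _ - X](bigD1 k) //=.
rewrite -!/(period _ _) !pa !eqxx !big1 => [|l lk|l lj].
- by rewrite !addr0 mul1r mulr1 => /eqP; rewrite subr_eq0 => /eqP.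
- by rewrite -!/(period _ _) pa (negPf lk) mulr0.
- by rewrite -!/(period _ _) pa (negPf lj) mul0r.
Qed.

End RiemannBilinear.

(** * The matrix relation and complex multiplication *)

(** Put w = v - Om u and w' = v' - Om u'. As [Om] is symmetric, the left side is w' w^T - w w'^T,
    which vanishes because w' = d w. *)
Lemma symmetric_wedge_relation (K : comNzRingType) h (Om : 'M[K]_h)
    (u v u' v' : 'cV[K]_h) (d : K) :
  Om^T = Om -> v' - Om *m u' = d *: (v - Om *m u) ->
  Om *m (u' *m u^T - u *m u'^T) *m Om + Om *m (u *m v'^T - u' *m v^T)
    - (u *m v'^T - u' *m v^T)^T *m Om - (v *m v'^T - v' *m v^T) = 0.
Proof.
move=> sym rel.
have pT (w : 'cV[K]_h) : w^T *m Om = (Om *m w)^T by rewrite trmx_mul sym.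
rewrite mulmxBr mulmxBl mulmxBr linearB /= !trmx_mul !trmxK mulmxBl.
rewrite !(mulmxA Om) -!(mulmxA _ _ Om) !pT.
move: (Om *m u) (Om *m u') rel => p p' rel.
have relE j : v' j 0 = d * (v j 0 - p j 0) + p' j 0.
  by have /matrixP/(_ j 0) := rel; rewrite !mxE => /eqP; rewrite subr_eq => /eqP.
by apply/matrixP => j k; rewrite !mxE !big_ord1 !mxE !relE; ring.
Qed.

Theorem mainTheorem5 (R : realType) (S : riemannSurface R) (h : nat)
    (s : chain R S 2) (alpha beta : 'I_h -> chain R S 1)
    (omega : 'I_h -> one_form S) (n m n' m' : 'rV[int]_h) (c : CC R) :
  compact [set: S] ->
  (1 <= h)%N ->
  fundamental_cycle s ->
  symplectic_basis s alpha beta ->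
  holomorphic_basis omega ->
  (forall j k, period (omega k) (alpha j) = (j == k)%:R) ->
  let Omega := period_matrix omega beta in
  (n, m) <> (0, 0) ->
  (forall q : rat, c <> ratr q) ->
  (forall j, (m' 0 j)%:~R - \sum_k Omega j k * (n' 0 k)%:~R =
     c^* * ((m 0 j)%:~R - \sum_k Omega j k * (n 0 k)%:~R)) ->
  let N : 'M[int]_h := \matrix_(j, k) (n' 0 j * n 0 k - n' 0 k * n 0 j) in
  let M : 'M[int]_h := \matrix_(j, k) (m' 0 k * n 0 j - m 0 k * n' 0 j) in
  let M' : 'M[int]_h := \matrix_(j, k) (m' 0 k * m 0 j - m' 0 j * m 0 k) in
  [/\ Omega *m intmx R N *m Omega + Omega *m intmx R M
        - (intmx R M)^T *m Omega - intmx R M' = 0,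
      cm_relation Omega N M M' M^T &
      admits_complex_multiplication Omega].
Proof.
move=> _ _ [cs _] sb [ho _] pa Omega _ _ rel N M M'.
have sym : Omega^T = Omega by exact: period_matrix_sym cs sb ho pa.
clearbody Omega.
pose col (u : 'rV[int]_h) : 'cV[CC R]_h := \col_j (u 0 j)%:~R.
have NE : intmx R N = col n' *m (col n)^T - col n *m (col n')^T.
  apply/matrixP => j k; rewrite !mxE !big_ord1 !mxE rmorphB !rmorphM /=.
  by rewrite [X in _ - X]mulrC.
have ME : intmx R M = col n *m (col m')^T - col n' *m (col m)^T.
  apply/matrixP => j k; rewrite !mxE !big_ord1 !mxE rmorphB !rmorphM /=.
  by rewrite mulrC [X in _ - X]mulrC.
have M'E : intmx R M' = col m *m (col m')^T - col m' *m (col m)^T.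
  apply/matrixP => j k; rewrite !mxE !big_ord1 !mxE rmorphB !rmorphM /=.
  by rewrite mulrC.
have Omega_col u j : (Omega *m col u) j 0 = \sum_k Omega j k * (u 0 k)%:~R.
  by rewrite mxE; apply: eq_bigr => k _; rewrite [col _ _ _]mxE.
have main : Omega *m intmx R N *m Omega + Omega *m intmx R M
        - (intmx R M)^T *m Omega - intmx R M' = 0.
  rewrite NE ME M'E; apply: (symmetric_wedge_relation (d := c^*)) sym _.
  apply/matrixP => j k; rewrite ord1 {k}.
  transitivity ((m' 0 j)%:~R - (Omega *m col n') j 0); first by rewrite !mxE.
  by rewrite Omega_col rel -Omega_col !mxE.
(* This is the relation [main] with its two subtracted terms moved to the right. *)
have cm : cm_relation Omega N M M' M^T.
  rewrite /cm_relation /intmx -map_trmx mulmxDr mulmxA -!/(intmx _ _).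
  apply/eqP; rewrite -subr_eq0 -[X in _ == X]main; apply/eqP.
  by rewrite (addrC (Omega *m _)) (addrC (intmx R M')) opprD addrA.
by split=> //; exists N, M, M', M^T.
Qed.
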